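(* Let $X$ be a complex Hilbert space and let $(T(t))_{t\ge 0}$ be a bounded $C_0$-semigroup on $X$ (that is, $\sup_{t\ge 0}\|T(t)\|<\infty$) with infinitesimal generator $A$. Then $(T(t))_{t\ge 0}$ is exponentially stable if and only if $i\mathbb{R}\subseteq\rho(A)$ and $\sup_{s\in\mathbb{R}}\|R(is,A)\|<\infty$.
   Context: A $C_0$-semigroup $(T(t))_{t\ge 0}$ on $X$ is called exponentially stable if there exist $\omega>0$ and $M\ge 1$ such that $\|T(t)\|\le M e^{-\omega t}$ for all $t\ge 0$. For the (in general unbounded) generator $A$, $\rho(A)$ denotes the resolvent set of $A$, and $R(\lambda,A)=(\lambda-A)^{-1}$ denotes the resolvent operator at $\lambda\in\rho(A)$. The set $i\mathbb{R}$ is the imaginary axis in $\mathbb{C}$. All operator norms are the norms of bounded linear operators on $X$. *)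

(* Defs.v *)
From Stdlib Require Import Reals.
From Coquelicot Require Import Coquelicot.

Open Scope R_scope.

(* [inner_norm] says that the norm of the space is induced by the inner
   product; it contains positivity, and definiteness follows since
   [norm x = 0] implies [x = zero]. *)
Record is_inner_product (X : NormedModule C_AbsRing) (inner : X -> X -> C)
  : Prop := {
  inner_plus_l : forall x y z, inner (plus x y) z = (inner x z + inner y z)%C;
  inner_scal_l : forall (a : C) x y, inner (scal a x) y = (a * inner x y)%C;
  inner_conj : forall x y, inner y x = Cconj (inner x y);
  inner_norm : forall x, inner x x = RtoC (norm x ^ 2)
}.

Record HilbertSpace := {
  hilbert_space :> CompleteNormedModule C_AbsRing;
  inner : hilbert_space -> hilbert_space -> C;
  inner_product : is_inner_product hilbert_space inner
}.

(* The supremum is taken in the extended reals: it is [p_infty] for an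
   unbounded linear map. *)
Definition op_norm {X : NormedModule C_AbsRing} (L : X -> X) : Rbar :=
  Lub_Rbar (fun r => exists x, norm x <= 1 /\ r = norm (L x)).

(* Semigroups are total functions of a real time, of which only the values at
   nonnegative times matter. [is_linear] includes boundedness. *)
Record is_C0_semigroup {X : NormedModule C_AbsRing} (T : R -> X -> X)
  : Prop := {
  semigroup_linear : forall t, 0 <= t -> is_linear (T t);
  semigroup_0 : forall x, T 0 x = x;
  semigroup_plus :
    forall s t x, 0 <= s -> 0 <= t -> T (s + t) x = T s (T t x);
  semigroup_continuous :
    forall x, filterlim (fun t => T t x) (at_right 0) (locally x)
}.

Definition bounded_semigroup {X : NormedModule C_AbsRing} (T : R -> X -> X)
  : Prop :=
  exists K : R, forall t, 0 <= t -> Rbar_le (op_norm (T t)) K.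

Definition exponentially_stable {X : NormedModule C_AbsRing}
    (T : R -> X -> X) : Prop :=
  exists omega M : R, 0 < omega /\ 1 <= M /\
    forall t, 0 <= t -> Rbar_le (op_norm (T t)) (M * exp (- omega * t)).

(* An unbounded operator A is given by its graph: [A x y] means that x is in
   the domain of A and A x = y. *)
Definition generator {X : NormedModule C_AbsRing} (T : R -> X -> X)
  : X -> X -> Prop :=
  fun x y =>
    filterlim (fun h => scal (RtoC (/ h)) (minus (T h x) x))
      (at_right 0) (locally y).

Definition shift_graph {X : NormedModule C_AbsRing} (A : X -> X -> Prop)
    (lambda : C) (x y : X) : Prop :=
  exists z, A x z /\ minus (scal lambda x) z = y.

(* [iota P] is the unique element satisfying P when there is one, so the value
   of [resolvent A lambda] is meaningful for lambda in the resolvent set. *)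
Definition resolvent {X : CompleteNormedModule C_AbsRing}
    (A : X -> X -> Prop) (lambda : C) : X -> X :=
  fun y => iota (fun x => shift_graph A lambda x y).

Definition resolvent_set {X : CompleteNormedModule C_AbsRing}
    (A : X -> X -> Prop) (lambda : C) : Prop :=
  (forall y, exists! x, shift_graph A lambda x y) /\
  is_linear (resolvent A lambda).

(* Main.v *)
Require Import Defs.
From Stdlib Require Import Reals Lra Lia Psatz List.
From Coquelicot Require Import Coquelicot.
Open Scope R_scope.

(** Both directions pass through contractions: a bounded semigroup is
    exponentially stable exactly when some [T tau] has norm at most 1/2
    ([contraction_exponentially_stable], [exponentially_stable_contraction]).

    From stability to the resolvent. The rotated semigroup
    [S t = exp (- i s t) T t] has generator [A - i s] and satisfies the same
    norm bounds as [T], so it suffices to invert the generator of [S] with a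
    bound independent of [s]. Formally the inverse is minus the integral of
    [S t] over all positive times. Writing [F t] for the integral of [S r y] over
    [0, t], the Neumann series solves [x - S tau x = F tau]; the symmetry
    [S h (F tau) - F tau = S tau (F h) - F h] and injectivity of [1 - S tau] give
    [S h x - x = - F h], and dividing by [h] shows that the generator maps [x] to
    [- y] ([contraction_generator_surj], [contraction_resolvent]).

    From the resolvent to stability. The mechanism is Plancherel's identity for
    the inhomogeneous equation [u' = A u + g]: on the Fourier side it reads
    [(i omega - A) u^ = g^], so a resolvent bound [K] on the imaginary axis gives
    [|u| <= K |g|] in L2. Take [u t = chi t * T t x] on [0, L] with a weight
    [chi] vanishing at both ends; then [g t = chi' t * T t x] has size
    [O(M |x| / L)], whereas [M |u t| >= |chi t| |T L x|]. Hence [|T L x|] is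
    [O(|x| / L)], and [T L] is a contraction for large [L].

    This argument is carried out on a periodic grid with [n + 1] points, where
    Parseval's identity is a finite algebraic fact ([parseval]). The derivative is
    replaced by the central difference quotient with step [h]. Its Fourier
    multiplier at frequency [theta] is [i sin theta / h], again a point of the
    imaginary axis, so that the resolvent bound applies without loss at every
    frequency, and the energy inequality holds exactly on each grid
    ([central_difference_energy]). For [x] in the domain of [A] the residual [g]
    differs from [chi' T x] by an error vanishing with [h]
    ([weighted_orbit_residual]); refining the grid gives the decay estimate on the
    domain ([orbit_decay]), which extends by density. *)

(** * Linear identities and norms *)

(** Syntax of formal linear combinations, for deciding linear identities by
    comparing coefficients. *)
Inductive vexpr : Type :=
| Vzero : vexpr
| Vatom : nat -> vexpr
| Vplus : vexpr -> vexpr -> vexpr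
| Vopp : vexpr -> vexpr
| Vscal : C -> vexpr -> vexpr.

Fixpoint vcoef (e : vexpr) (n : nat) : C :=
  match e with
  | Vzero => RtoC 0
  | Vatom m => if Nat.eqb m n then RtoC 1 else RtoC 0
  | Vplus a b => (vcoef a n + vcoef b n)%C
  | Vopp a => (- vcoef a n)%C
  | Vscal c a => (c * vcoef a n)%C
  end.

Fixpoint veval {V : ModuleSpace C_Ring} (l : list V) (e : vexpr) : V :=
  match e with
  | Vzero => zero
  | Vatom m => nth m l zero
  | Vplus a b => plus (veval l a) (veval l b)
  | Vopp a => opp (veval l a)
  | Vscal c a => scal c (veval l a)
  end.

Fixpoint lincomb {V : ModuleSpace C_Ring} (l : list V) (c : nat -> C) : V :=
  match l with
  | nil => zero
  | x :: l' => plus (scal (c O) x) (lincomb l' (fun n => c (S n)))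
  end.

Lemma lincomb_zero {V : ModuleSpace C_Ring} (l : list V) (c : nat -> C) :
  (forall n, c n = RtoC 0) -> lincomb l c = zero.
Proof.
  revert c; induction l as [|x l IH]; intros c Hc; simpl; [reflexivity|].
  rewrite Hc, IH by (intros n; apply Hc).
  rewrite plus_zero_r. exact (scal_zero_l x).
Qed.

Lemma lincomb_plus {V : ModuleSpace C_Ring} (l : list V) (c d : nat -> C) :
  lincomb l (fun n => (c n + d n)%C) = plus (lincomb l c) (lincomb l d).
Proof.
  revert c d; induction l as [|x l IH]; intros c d; simpl.
  - now rewrite plus_zero_l.
  - rewrite IH.
    replace (scal (c O + d O)%C x) with (plus (scal (c O) x) (scal (d O) x))
      by (symmetry; exact (scal_distr_r (K := C_Ring) (c O) (d O) x)).
    rewrite <- !plus_assoc. f_equal.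
    rewrite !plus_assoc. f_equal. apply plus_comm.
Qed.

Lemma lincomb_scal {V : ModuleSpace C_Ring} (l : list V) (a : C) (c : nat -> C) :
  lincomb l (fun n => (a * c n)%C) = scal a (lincomb l c).
Proof.
  revert c; induction l as [|x l IH]; intros c; simpl.
  - symmetry; exact (scal_zero_r (K := C_Ring) a).
  - rewrite IH, (scal_distr_l (K := C_Ring)). f_equal.
    symmetry; exact (scal_assoc (K := C_Ring) a (c O) x).
Qed.

Lemma lincomb_ext {V : ModuleSpace C_Ring} (l : list V) (c d : nat -> C) :
  (forall n, c n = d n) -> lincomb l c = lincomb l d.
Proof.
  revert c d; induction l as [|x l IH]; intros c d H; simpl; [reflexivity|].
  rewrite H; f_equal; apply IH; intros n; apply H.
Qed.

Lemma veval_lincomb {V : ModuleSpace C_Ring} (l : list V) (e : vexpr) :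
  veval l e = lincomb l (vcoef e).
Proof.
  induction e as [|m|a IHa b IHb|a IHa|c a IHa]; simpl.
  - now rewrite lincomb_zero.
  - revert m; induction l as [|x l IH]; intros [|m]; simpl.
    1,2: reflexivity.
    + rewrite lincomb_zero by reflexivity.
      rewrite plus_zero_r; symmetry; exact (scal_one x).
    + rewrite IH.
      replace (scal (RtoC 0) x) with (zero : V) by (symmetry; exact (scal_zero_l x)).
      now rewrite plus_zero_l.
  - now rewrite IHa, IHb, lincomb_plus.
  - rewrite IHa.
    rewrite (lincomb_ext l (fun n => (- vcoef a n)%C)
               (fun n => (- RtoC 1 * vcoef a n)%C)) by (intros n; ring).
    rewrite lincomb_scal. symmetry.
    exact (scal_opp_one (K := C_Ring) (lincomb l (vcoef a))).
  - now rewrite IHa, lincomb_scal.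
Qed.

(** Reflection principle behind [vfield]: a module identity reduces to one
    identity in the field [C] per atom. *)
Lemma veval_eq {V : ModuleSpace C_Ring} (l : list V) (e1 e2 : vexpr) :
  lincomb l (vcoef e1) = lincomb l (vcoef e2) -> veval l e1 = veval l e2.
Proof. now rewrite !veval_lincomb. Qed.

Ltac vmember x l :=
  lazymatch l with
  | nil => constr:(false)
  | x :: _ => constr:(true)
  | _ :: ?l' => vmember x l'
  end.

Ltac vindex x l :=
  lazymatch l with
  | x :: _ => constr:(O)
  | _ :: ?l' => let n := vindex x l' in constr:(S n)
  end.

Ltac vatoms e l :=
  lazymatch e with
  | plus ?a ?b => let l1 := vatoms a l in vatoms b l1
  | minus ?a ?b => let l1 := vatoms a l in vatoms b l1
  | opp ?a => vatoms a l
  | scal _ ?a => vatoms a l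
  | zero => l
  | ?x => lazymatch vmember x l with
          | true => l
          | false => constr:(x :: l)
          end
  end.

Ltac vquote e l :=
  lazymatch e with
  | plus ?a ?b =>
      let a' := vquote a l in let b' := vquote b l in constr:(Vplus a' b')
  | minus ?a ?b =>
      let a' := vquote a l in let b' := vquote b l in
      constr:(Vplus a' (Vopp b'))
  | opp ?a => let a' := vquote a l in constr:(Vopp a')
  | scal ?c ?a => let a' := vquote a l in constr:(Vscal c a')
  | zero => constr:(Vzero)
  | ?x => let n := vindex x l in constr:(Vatom n)
  end.

(** Proves linear identities whose coefficients agree by field arithmetic
    in [C], possibly leaving nonzeroness conditions. *)
Ltac vfield :=
  lazymatch goal with
  | |- @eq ?T ?a ?b =>
      let l0 := vatoms a (@nil T) in
      let l := vatoms b l0 in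
      let e1 := vquote a l in
      let e2 := vquote b l in
      let H := fresh in
      pose proof (veval_eq l e1 e2) as H;
      cbn [veval nth] in H;
      apply H; clear H;
      cbn [lincomb vcoef Nat.eqb];
      repeat (apply f_equal2; [apply f_equal2;
                [ lazymatch goal with |- @eq _ ?u ?v => change (@eq C u v) end;
                  try field
                | reflexivity ] | ]);
      try reflexivity
  end.

Lemma norm_scal_C {V : NormedModule C_AbsRing} (a : C) (x : V) :
  norm (scal a x) = Cmod a * norm x.
Proof.
  apply Rle_antisym; [exact (norm_scal a x)|].
  destruct (Ceq_dec a 0) as [->|Ha].
  - rewrite Cmod_0, Rmult_0_l. apply norm_ge_0.
  - assert (E : scal (/ a)%C (scal a x) = x) by (vfield; exact Ha).
    assert (H : norm x <= Cmod (/ a) * norm (scal a x))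
      by (rewrite <- E at 1; exact (norm_scal (/ a)%C (scal a x))).
    rewrite Cmod_inv in H by exact Ha.
    apply Cmod_gt_0 in Ha.
    apply Rmult_le_compat_l with (r := Cmod a) in H; [|lra].
    rewrite <- Rmult_assoc, Rinv_r, Rmult_1_l in H by lra.
    exact H.
Qed.

Lemma norm_scal_RtoC {V : NormedModule C_AbsRing} (r : R) (x : V) :
  norm (scal (RtoC r) x) = Rabs r * norm x.
Proof. now rewrite norm_scal_C, Cmod_R. Qed.

Lemma norm_triangle_C {V : NormedModule C_AbsRing} (x y : V) :
  norm (plus x y) <= norm x + norm y.
Proof. apply norm_triangle. Qed.

Lemma norm_minus_le {V : NormedModule C_AbsRing} (x y : V) :
  norm (minus x y) <= norm x + norm y.
Proof.
  unfold minus. eapply Rle_trans; [apply norm_triangle|].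
  rewrite norm_opp. apply Rle_refl.
Qed.

Lemma norm_eq_le {V : NormedModule C_AbsRing} (y x : V) (r : R) :
  x = y -> norm y <= r -> norm x <= r.
Proof. now intros ->. Qed.

Lemma minus_zero_eq {V : NormedModule C_AbsRing} (x y : V) :
  minus x y = zero -> x = y.
Proof.
  intros H. transitivity (plus (minus x y) y); [vfield|].
  rewrite H. apply plus_zero_l.
Qed.

Lemma norm_small_eq {V : NormedModule C_AbsRing} (x y : V) :
  (forall eps, 0 < eps -> norm (minus x y) <= eps) -> x = y.
Proof.
  intros H. apply minus_zero_eq, norm_eq_zero, Rle_antisym; [|apply norm_ge_0].
  apply le_epsilon. intros eps Heps. rewrite Rplus_0_l. now apply H.
Qed.

Lemma linear_minus {V : NormedModule C_AbsRing} (L : V -> V) (x y : V) :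
  is_linear L -> L (minus x y) = minus (L x) (L y).
Proof.
  intros HL.
  replace (minus x y) with (plus x (scal (RtoC (-1)) y)) by vfield.
  rewrite (linear_plus L HL), (linear_scal L HL). vfield.
Qed.

Lemma linear_zero {V : NormedModule C_AbsRing} (L : V -> V) :
  is_linear L -> L zero = zero.
Proof.
  intros HL. replace (zero : V) with (minus zero zero : V) at 1 by vfield.
  rewrite linear_minus by exact HL. vfield.
Qed.

(** * Operator norms as pointwise bounds *)

(** The supremum runs over the unit ball only, so a vector has to be normalised;
    vectors of norm 0 are handled by the boundedness built into linearity. *)
Lemma op_norm_bound {V : NormedModule C_AbsRing} (L : V -> V) (K : R) :
  is_linear L -> Rbar_le (op_norm L) (Finite K) ->
  forall x, norm (L x) <= K * norm x.
Proof.
  intros HL HK x.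
  destruct (Req_dec (norm x) 0) as [E|E].
  - destruct (linear_norm L HL) as [M [_ HM]].
    specialize (HM x). rewrite E in *. lra.
  - assert (P : 0 < norm x) by (pose proof (norm_ge_0 x); lra).
    assert (H : norm (L (scal (RtoC (/ norm x)) x)) <= K).
    { change (Rbar_le (norm (L (scal (RtoC (/ norm x)) x))) K).
      apply Rbar_le_trans with (op_norm L); [|exact HK].
      apply (proj1 (Lub_Rbar_correct _)).
      exists (scal (RtoC (/ norm x)) x); split; [|reflexivity].
      rewrite norm_scal_RtoC, Rabs_pos_eq, Rinv_l by
        (auto using Rlt_le, Rinv_0_lt_compat). lra. }
    rewrite (linear_scal L HL), norm_scal_RtoC, Rabs_pos_eq in H by
      (auto using Rlt_le, Rinv_0_lt_compat).
    apply Rmult_le_compat_r with (r := norm x) in H; [|lra].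
    replace (/ norm x * norm (L x) * norm x) with (norm (L x)) in H
      by (field; exact E).
    exact H.
Qed.

Lemma op_norm_le {V : NormedModule C_AbsRing} (L : V -> V) (K : R) :
  0 <= K -> (forall x, norm (L x) <= K * norm x) ->
  Rbar_le (op_norm L) (Finite K).
Proof.
  intros HK HL. apply (proj2 (Lub_Rbar_correct _)).
  intros r [x [Hx ->]]. simpl.
  apply Rle_trans with (1 := HL x).
  rewrite <- (Rmult_1_r K) at 2. now apply Rmult_le_compat_l.
Qed.

(** * Bounded semigroups and their generators *)

Lemma filterlim_at_right_0 {V : NormedModule C_AbsRing} (f : R -> V) (y : V) :
  filterlim f (at_right 0) (locally y) <->
  (forall eps, 0 < eps -> exists delta, 0 < delta /\
     forall h, 0 < h < delta -> norm (minus (f h) y) < eps).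
Proof.
  split.
  - intros H eps Heps.
    apply (filterlim_locally_ball_norm (F := at_right 0)) with
      (eps := mkposreal eps Heps) in H.
    destruct H as [d Hd]. exists d; split; [apply cond_pos|].
    intros h [h0 h1]. apply Hd; [|exact h0].
    change (Rabs (h - 0) < d).
    rewrite Rminus_0_r, Rabs_pos_eq; lra.
  - intros H. apply (filterlim_locally_ball_norm (F := at_right 0)).
    intros eps. destruct (H eps (cond_pos eps)) as [d [Hd H']].
    exists (mkposreal d Hd). intros h Hh h0. apply H'.
    split; [exact h0|].
    change (Rabs (h - 0) < d) in Hh.
    rewrite Rminus_0_r, Rabs_pos_eq in Hh; lra.
Qed.

Lemma generator_iff {V : NormedModule C_AbsRing} (T : R -> V -> V) (x y : V) :
  generator T x y <->
  (forall eps, 0 < eps -> exists delta, 0 < delta /\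
     forall h, 0 < h < delta ->
       norm (minus (minus (T h x) x) (scal (RtoC h) y)) <= eps * h).
Proof.
  eapply iff_trans; [apply filterlim_at_right_0|].
  assert (E : forall h, 0 < h ->
    norm (minus (minus (T h x) x) (scal (RtoC h) y)) =
    h * norm (minus (scal (RtoC (/ h)) (minus (T h x) x)) y)).
  { intros h Hh.
    transitivity (norm (scal (RtoC h)
      (minus (scal (RtoC (/ h)) (minus (T h x) x)) y))).
    - assert (RtoC h <> 0) by (intros H; apply RtoC_inj in H; lra).
      f_equal. rewrite RtoC_inv by lra. vfield; assumption.
    - rewrite norm_scal_RtoC, Rabs_pos_eq; lra. }
  split; intros H eps Heps.
  - destruct (H eps Heps) as [d [Hd H']]. exists d; split; [exact Hd|].
    intros h Hh. rewrite E by lra. rewrite (Rmult_comm eps).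
    apply Rmult_le_compat_l; [lra|]. exact (Rlt_le _ _ (H' h Hh)).
  - destruct (H (eps / 2)) as [d [Hd H']]; [lra|].
    exists d; split; [exact Hd|]. intros h Hh.
    specialize (H' h Hh). rewrite E in H' by lra.
    rewrite (Rmult_comm (eps / 2)) in H'.
    apply Rmult_le_reg_l in H'; [|lra].
    apply Rle_lt_trans with (1 := H'). lra.
Qed.

Definition bounded_by {V : NormedModule C_AbsRing} (M : R) (T : R -> V -> V) :=
  forall t x, 0 <= t -> norm (T t x) <= M * norm x.

Lemma bounded_semigroup_bound {V : NormedModule C_AbsRing} (T : R -> V -> V) :
  is_C0_semigroup T -> bounded_semigroup T ->
  exists M, 1 <= M /\ bounded_by M T.
Proof.
  intros HT [K HK]. exists (Rmax 1 K). split; [apply Rmax_l|].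
  intros t x Ht.
  apply Rle_trans with (K * norm x).
  - apply op_norm_bound; [now apply HT | now apply HK].
  - apply Rmult_le_compat_r; [apply norm_ge_0 | apply Rmax_r].
Qed.

Lemma generator_plus {V : NormedModule C_AbsRing} (T : R -> V -> V) x y x' y' :
  is_C0_semigroup T ->
  generator T x y -> generator T x' y' -> generator T (plus x x') (plus y y').
Proof.
  rewrite !generator_iff. intros HT H H' eps Heps.
  destruct (H (eps / 2)) as [d [Hd K]]; [lra|].
  destruct (H' (eps / 2)) as [d' [Hd' K']]; [lra|].
  exists (Rmin d d'). split; [now apply Rmin_pos|]. intros h Hh.
  pose proof (Rmin_l d d'). pose proof (Rmin_r d d').
  specialize (K h ltac:(lra)). specialize (K' h ltac:(lra)).
  rewrite (linear_plus _ (semigroup_linear _ HT h ltac:(lra))).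
  replace (minus _ _) with
    (plus (minus (minus (T h x) x) (scal (RtoC h) y))
          (minus (minus (T h x') x') (scal (RtoC h) y'))) by vfield.
  eapply Rle_trans; [apply norm_triangle | lra].
Qed.

(** Applied to multiplication by a scalar and to the operators [T t]. *)
Lemma generator_commute {V : NormedModule C_AbsRing} (T : R -> V -> V) L x y :
  is_linear L -> (forall h z, 0 <= h -> T h (L z) = L (T h z)) ->
  generator T x y -> generator T (L x) (L y).
Proof.
  rewrite !generator_iff. intros HL HC H eps Heps.
  destruct (linear_norm L HL) as [M [M0 HM]].
  destruct (H (eps / M)) as [d [Hd K]]; [now apply Rdiv_lt_0_compat|].
  exists d; split; [exact Hd|]. intros h Hh.
  rewrite HC, <- !(linear_scal L HL), <- !linear_minus by (auto; lra).
  eapply Rle_trans; [apply HM|].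
  replace (eps * h) with (M * (eps / M * h)) by (field; lra).
  apply Rmult_le_compat_l; [lra | now apply K].
Qed.

Lemma generator_scal {V : NormedModule C_AbsRing} (T : R -> V -> V) a x y :
  is_C0_semigroup T -> generator T x y -> generator T (scal a x) (scal a y).
Proof.
  intros HT. apply generator_commute.
  - exact (is_linear_scal_r a Cmult_comm).
  - intros h z Hh. apply (linear_scal _ (semigroup_linear _ HT h Hh)).
Qed.

Lemma generator_orbit {V : NormedModule C_AbsRing} (T : R -> V -> V) t x y :
  is_C0_semigroup T -> 0 <= t -> generator T x y -> generator T (T t x) (T t y).
Proof.
  intros HT Ht. apply generator_commute; [now apply HT|].
  intros h z Hh. rewrite <- !(semigroup_plus _ HT) by assumption.
  now rewrite Rplus_comm.
Qed.

Lemma generator_sum_n {V : NormedModule C_AbsRing} (T : R -> V -> V)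
    (u v : nat -> V) n :
  is_C0_semigroup T -> (forall j, generator T (u j) (v j)) ->
  generator T (sum_n u n) (sum_n v n).
Proof.
  intros HT H; induction n as [|n IH]; [rewrite !sum_O; apply H|].
  rewrite !sum_Sn. now apply generator_plus.
Qed.

Lemma semigroup_iter {V : NormedModule C_AbsRing} (T : R -> V -> V) h x n M :
  is_C0_semigroup T -> bounded_by M T -> 0 <= h ->
  norm (minus (T (INR n * h) x) x) <= INR n * M * norm (minus (T h x) x).
Proof.
  intros HT HM Hh. induction n as [|n IH].
  - simpl. rewrite !Rmult_0_l, (semigroup_0 _ HT).
    replace (minus x x) with (zero : V) by vfield. rewrite norm_zero; lra.
  - assert (Hn : 0 <= INR n * h) by (apply Rmult_le_pos; [apply pos_INR | lra]).
    rewrite S_INR, Rmult_plus_distr_r, Rmult_1_l, (semigroup_plus _ HT) by lra.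
    replace (minus (T (INR n * h) (T h x)) x) with
      (plus (minus (T (INR n * h) (T h x)) (T (INR n * h) x))
            (minus (T (INR n * h) x) x)) by vfield.
    rewrite <- linear_minus by now apply HT.
    eapply Rle_trans; [apply norm_triangle|].
    specialize (HM (INR n * h) (minus (T h x) x) Hn). lra.
Qed.

(** Over [n] steps of length [t / n] the displacement is at most
    [n M] times that of one step, which is [o (t / n)]. *)
Lemma generator_zero_fixed {V : NormedModule C_AbsRing} (T : R -> V -> V) x M :
  is_C0_semigroup T -> 1 <= M -> bounded_by M T ->
  generator T x zero -> forall t, 0 <= t -> T t x = x.
Proof.
  intros HT M1 HM Hx t Ht.
  destruct (Req_dec t 0) as [->|Ht0]; [apply HT|].
  apply norm_small_eq. intros eps Heps.
  rewrite generator_iff in Hx.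
  destruct (Hx (eps / (M * t))) as [d [Hd H]].
  { apply Rdiv_lt_0_compat; [lra|]. apply Rmult_lt_0_compat; lra. }
  destruct (archimed_cor1 (d / t)) as [n [Hn n0]].
  { apply Rdiv_lt_0_compat; lra. }
  apply lt_INR in n0; simpl in n0.
  assert (Hh : 0 < t / INR n < d).
  { split; [apply Rdiv_lt_0_compat; lra|].
    apply Rmult_lt_compat_r with (r := t) in Hn; [|lra].
    replace (d / t * t) with d in Hn by (field; lra).
    unfold Rdiv; lra. }
  pose proof (semigroup_iter T (t / INR n) x n M HT HM ltac:(lra)) as I.
  replace (INR n * (t / INR n)) with t in I by (field; lra).
  apply Rle_trans with (1 := I).
  specialize (H _ Hh).
  assert (E : norm (minus (T (t / INR n) x) x) =
    norm (minus (minus (T (t / INR n) x) x) (scal (RtoC (t / INR n)) zero)))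
    by (f_equal; vfield).
  rewrite E.
  apply Rmult_le_compat_l with (r := INR n * M) in H;
    [|apply Rmult_le_pos; lra].
  replace (INR n * M * (eps / (M * t) * (t / INR n))) with eps in H
    by (field; lra).
  exact H.
Qed.

(** The semigroup law turns one contraction at time [tau] into geometric
    decay along the multiples of [tau], with rate [ln 2 / tau]; the factor [2 M]
    absorbs the last incomplete period. *)
Lemma contraction_exponentially_stable {V : NormedModule C_AbsRing}
    (T : R -> V -> V) M tau :
  is_C0_semigroup T -> 1 <= M -> bounded_by M T -> 0 < tau ->
  (forall x, norm (T tau x) <= / 2 * norm x) -> exponentially_stable T.
Proof.
  intros HT M1 HM Htau Hc.
  assert (Hn : forall n x, norm (T (INR n * tau) x) <= (/ 2) ^ n * norm x).
  { induction n as [|n IH]; intros x.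
    - simpl. rewrite Rmult_0_l, (semigroup_0 _ HT). lra.
    - rewrite S_INR, Rmult_plus_distr_r, Rmult_1_l, (semigroup_plus _ HT)
        by (try apply Rmult_le_pos; try apply pos_INR; lra).
      eapply Rle_trans; [apply IH|]. simpl.
      specialize (Hc x). assert (0 < (/ 2) ^ n) by (apply pow_lt; lra). nra. }
  exists (ln 2 / tau), (2 * M).
  assert (L2 : 0 < ln 2) by (rewrite <- ln_1; apply ln_increasing; lra).
  split; [now apply Rdiv_lt_0_compat|]. split; [lra|].
  intros t Ht.
  destruct (nfloor_ex (t / tau)) as [n [n1 n2]];
    [apply Rdiv_le_0_compat; lra|].
  assert (Et : t = t / tau * tau) by (field; lra).
  assert (Hr : INR n * tau <= t)
    by (rewrite Et at 1; apply Rmult_le_compat_r; lra).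
  assert (Hp : (/ 2) ^ n <= 2 * exp (- (ln 2 / tau) * t)).
  { replace (- (ln 2 / tau) * t) with (- (ln 2 * (t / tau))) by (field; lra).
    replace ((/ 2) ^ n) with (2 * exp (- (ln 2 * (INR n + 1)))).
    - apply Rmult_le_compat_l; [lra|].
      destruct (Rle_lt_or_eq_dec (- (ln 2 * (INR n + 1))) (- (ln 2 * (t / tau))))
        as [l|e]; [nra| |rewrite e; lra].
      apply Rlt_le, exp_increasing, l.
    - replace (- (ln 2 * (INR n + 1))) with (INR n * ln (/ 2) + - ln 2)
        by (rewrite ln_Rinv by lra; ring).
      rewrite exp_plus, exp_Ropp, exp_ln by lra.
      change (exp (INR n * ln (/ 2))) with (Rpower (/ 2) (INR n)).
      rewrite Rpower_pow by lra. field. }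
  apply op_norm_le.
  - pose proof (exp_pos (- (ln 2 / tau) * t)). nra.
  - intros x.
    replace t with ((t - INR n * tau) + INR n * tau) at 1 by ring.
    rewrite (semigroup_plus _ HT)
      by (try apply Rmult_le_pos; try apply pos_INR; lra).
    eapply Rle_trans; [apply HM; lra|].
    replace (2 * M * exp (- (ln 2 / tau) * t) * norm x) with
      (M * (2 * exp (- (ln 2 / tau) * t) * norm x)) by ring.
    apply Rmult_le_compat_l; [lra|].
    eapply Rle_trans; [apply Hn|].
    apply Rmult_le_compat_r; [apply norm_ge_0 | exact Hp].
Qed.

(** * Integrals of orbits *)

Definition realify_ModuleSpace_mixin (V : ModuleSpace C_Ring) :
  ModuleSpace.mixin_of R_Ring V.
Proof.
  apply (ModuleSpace.Mixin R_Ring V (fun r x => scal (RtoC r) x)).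
  - intros r s x. unfold mult; simpl. rewrite RtoC_mult.
    exact (scal_assoc (K := C_Ring) (RtoC r) (RtoC s) x).
  - intros x. exact (scal_one (K := C_Ring) x).
  - intros r x y. exact (scal_distr_l (K := C_Ring) (RtoC r) x y).
  - intros r s x. unfold plus at 1; simpl. rewrite RtoC_plus.
    exact (scal_distr_r (K := C_Ring) (RtoC r) (RtoC s) x).
Defined.

Definition realify_NormedModuleAux (V : NormedModule C_AbsRing) :
  NormedModuleAux R_AbsRing :=
  NormedModuleAux.Pack R_AbsRing V
    (NormedModuleAux.Class R_AbsRing V
      (ModuleSpace.Class R_Ring V _ (realify_ModuleSpace_mixin V))
      (UniformSpace.class V)) V.

Definition realify_NormedModule_mixin (V : NormedModule C_AbsRing) :
  NormedModule.mixin_of R_AbsRing (realify_NormedModuleAux V).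
Proof.
  apply (NormedModule.Mixin R_AbsRing (realify_NormedModuleAux V)
           (fun x : V => norm x) (norm_factor (V := V))).
  - exact (norm_triangle (V := V)).
  - intros r x. change (norm (scal (RtoC r) (x : V)) <= Rabs r * norm (x : V)).
    rewrite norm_scal_RtoC. apply Rle_refl.
  - exact (norm_compat1 (V := V)).
  - exact (norm_compat2 (V := V)).
  - exact (norm_eq_zero (V := V)).
Defined.

(** The underlying real Banach space: vector-valued Riemann integrals are
    integrals over the real scalars. *)
Definition realify (V : CompleteNormedModule C_AbsRing) :
  CompleteNormedModule R_AbsRing :=
  CompleteNormedModule.Pack R_AbsRing V
    (CompleteNormedModule.Class R_AbsRing V
      (NormedModule.Class R_AbsRing V
        (NormedModuleAux.class R_AbsRing (realify_NormedModuleAux V))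
        (realify_NormedModule_mixin V))
      (CompleteSpace.mixin _ (CompleteSpace.class V))) V.

(** Continuous linear maps commute with Riemann sums, hence with their limits. *)
Lemma is_RInt_linear (V : CompleteNormedModule C_AbsRing) (L : V -> V)
    (f : R -> realify V) (a b : R) (l : realify V) :
  is_linear L -> is_RInt f a b l ->
  is_RInt (fun t => L (f t) : realify V) a b (L l).
Proof.
  intros HL H. unfold is_RInt in *.
  assert (ES : forall s, Riemann_sum (fun t => L (f t) : realify V) s =
                         L (Riemann_sum f s)).
  { apply SF_cons_ind.
    - intros x. unfold Riemann_sum; simpl.
      exact (eq_sym (linear_zero L HL)).
    - intros h s IH. rewrite !Riemann_sum_cons, IH.
      symmetry. etransitivity; [apply (linear_plus L HL)|]. f_equal.
      apply (linear_scal L HL). }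
  apply filterlim_ext with
    (fun s => L (scal (sign (b - a)) (Riemann_sum f s) : realify V)).
  - intros s. rewrite ES. apply (linear_scal L HL).
  - eapply filterlim_comp; [exact H|].
    exact (linear_cont L l HL).
Qed.

Lemma orbit_modulus {V : NormedModule C_AbsRing} (T : R -> V -> V) M x a b :
  is_C0_semigroup T -> bounded_by M T -> 0 <= a -> 0 <= b ->
  norm (minus (T a x) (T b x)) <= M * norm (minus (T (Rabs (a - b)) x) x).
Proof.
  intros HT HM.
  assert (D : forall a b, 0 <= a -> a <= b ->
    norm (minus (T b x) (T a x)) <= M * norm (minus (T (b - a) x) x)).
  { intros a' b' Ha Hab.
    replace b' with (a' + (b' - a')) at 1 by ring.
    rewrite (semigroup_plus _ HT), <- linear_minus by (try apply HT; lra).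
    now apply HM. }
  intros Ha Hb. destruct (Rle_dec a b) as [l|l].
  - rewrite Rabs_left1, Ropp_minus_distr by lra.
    replace (norm (minus (T a x) (T b x))) with (norm (minus (T b x) (T a x)));
      [now apply D|].
    rewrite <- norm_opp. f_equal. vfield.
  - rewrite Rabs_pos_eq by lra. apply D; lra.
Qed.

Lemma orbit_continuous_0 {V : NormedModule C_AbsRing} (T : R -> V -> V) x :
  is_C0_semigroup T -> forall eps, 0 < eps -> exists delta, 0 < delta /\
    forall h, 0 <= h < delta -> norm (minus (T h x) x) < eps.
Proof.
  intros HT eps Heps.
  pose proof (semigroup_continuous _ HT x) as H.
  rewrite (filterlim_at_right_0 (V := V)) in H.
  destruct (H eps Heps) as [d [Hd H']]. exists d; split; [exact Hd|].
  intros h Hh. destruct (Req_dec h 0) as [->|h0]; [|apply H'; lra].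
  rewrite (semigroup_0 _ HT).
  replace (minus x x) with (zero : V) by vfield. now rewrite norm_zero.
Qed.

(** The time is read through [Rabs] because the integral needs a function
    continuous at every real, while [T] is unconstrained at negative times. *)
Lemma orbit_continuous (V : CompleteNormedModule C_AbsRing) (T : R -> V -> V)
    M x s :
  is_C0_semigroup T -> 1 <= M -> bounded_by M T ->
  continuous (fun t => T (Rabs t) x : realify V) s.
Proof.
  intros HT M1 HM. unfold continuous.
  apply (filterlim_locally_ball_norm (K := C_AbsRing) (U := V)).
  intros eps.
  destruct (orbit_continuous_0 T x HT (eps / M)) as [d [Hd H]].
  { apply Rdiv_lt_0_compat; [apply cond_pos | lra]. }
  exists (mkposreal d Hd). intros t Ht. change (Rabs (t - s) < d) in Ht.
  unfold ball_norm.
  eapply Rle_lt_trans;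
    [apply (orbit_modulus T M); auto using Rabs_pos|].
  assert (K : norm (minus (T (Rabs (Rabs t - Rabs s)) x) x) < eps / M).
  { apply H. split; [apply Rabs_pos|].
    eapply Rle_lt_trans; [apply Rabs_triang_inv2 | exact Ht]. }
  apply Rmult_lt_compat_l with (r := M) in K; [|lra].
  replace (M * (eps / M)) with (pos eps) in K by (field; lra). exact K.
Qed.

(** What is needed of [F t], the integral of [T r y] for [r] from 0 to [t]:
    the first clause is translation of the integration interval. *)
Definition orbit_integral {V : NormedModule C_AbsRing} (T : R -> V -> V) (M : R)
    (y : V) (F : R -> V) : Prop :=
  (forall a b, 0 <= a -> 0 <= b -> T a (F b) = minus (F (a + b)) (F a)) /\
  (forall eps, 0 < eps -> exists delta, 0 < delta /\ forall h, 0 < h < delta ->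
     norm (minus (F h) (scal (RtoC h) y)) <= eps * h) /\
  (forall t, 0 <= t -> norm (F t) <= t * M * norm y).

Lemma orbit_integral_exists (V : CompleteNormedModule C_AbsRing) (T : R -> V -> V)
    M (y : V) :
  is_C0_semigroup T -> 1 <= M -> bounded_by M T ->
  exists F, orbit_integral T M y F.
Proof.
  intros HT M1 HM.
  set (f := fun t => T (Rabs t) y : realify V).
  assert (Hf : forall a b, ex_RInt f a b).
  { intros a b. apply ex_RInt_continuous. intros z _.
    now apply (orbit_continuous V T M). }
  exists (fun t => RInt f 0 t). split; [|split].
  - intros a b Ha Hb.
    assert (E1 : is_RInt (fun t => T a (f t) : realify V) 0 b (T a (RInt f 0 b))).
    { apply is_RInt_linear; [now apply HT|].
      exact (RInt_correct f 0 b (Hf 0 b)). }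
    assert (E2 : is_RInt (fun t => T a (f t) : realify V) 0 b (RInt f a (a + b))).
    { apply is_RInt_ext with (fun t => scal 1 (f (1 * t + a))).
      - intros t. rewrite Rmin_left, Rmax_right by lra. intros Ht.
        change 1 with (one : R_Ring) at 1. rewrite scal_one. unfold f.
        rewrite !Rabs_pos_eq by lra. rewrite <- (semigroup_plus _ HT) by lra.
        f_equal. ring.
      - apply (is_RInt_comp_lin (V := realify V) f 1 a 0 b).
        replace (1 * 0 + a) with a by ring.
        replace (1 * b + a) with (a + b) by ring.
        exact (RInt_correct f a (a + b) (Hf _ _)). }
    transitivity (RInt f a (a + b) : V).
    + apply is_RInt_unique in E1. apply is_RInt_unique in E2.
      transitivity (RInt (fun t => T a (f t) : realify V) 0 b); auto.
    + rewrite <- (RInt_Chasles f 0 a (a + b)) by apply Hf.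
      change (plus (RInt f 0 a) (RInt f a (a + b)))
        with (plus (RInt f 0 a : V) (RInt f a (a + b) : V)).
      vfield.
  - intros eps Heps.
    destruct (orbit_continuous_0 T y HT eps Heps) as [d [Hd H]].
    exists d; split; [exact Hd|]. intros h Hh.
    rewrite (Rmult_comm eps). rewrite <- (Rminus_0_r h) at 3.
    apply (norm_RInt_le_const (V := realify V)
             (fun t => minus (f t) (y : realify V)) 0 h); [lra| |].
    + intros t Ht. apply Rlt_le.
      change (norm (minus (T (Rabs t) y) y) < eps).
      rewrite Rabs_pos_eq by lra. apply H. lra.
    + apply (is_RInt_minus f (fun _ => y : realify V)).
      * exact (RInt_correct f 0 h (Hf _ _)).
      * pose proof (is_RInt_const 0 h (y : realify V)) as H0.
        rewrite Rminus_0_r in H0. exact H0.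
  - intros t Ht.
    replace (t * M * norm y) with ((t - 0) * (M * norm y)) by ring.
    apply (norm_RInt_le_const (V := realify V) f 0 t); [exact Ht| |].
    + intros r Hr. change (norm (T (Rabs r) y) <= M * norm y).
      apply HM, Rabs_pos.
    + exact (RInt_correct f 0 t (Hf _ _)).
Qed.

(** [T h (F t) - F t] is symmetric in [h] and [t], both being differences of
    integrals over shifted intervals; so it equals [T t (F h) - F h], where
    [F h / h] tends to [y]. *)
Lemma generator_orbit_integral {V : NormedModule C_AbsRing} (T : R -> V -> V)
    M y F t :
  is_C0_semigroup T -> orbit_integral T M y F -> 0 <= t ->
  generator T (F t) (minus (T t y) y).
Proof.
  intros HT [HF [HF0 _]] Ht. apply generator_iff. intros eps Heps.
  destruct (linear_norm _ (semigroup_linear _ HT t Ht)) as [B [B0 HB]].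
  destruct (HF0 (eps / (B + 1))) as [d [Hd H]].
  { apply Rdiv_lt_0_compat; lra. }
  exists d; split; [exact Hd|]. intros h Hh. specialize (H h Hh).
  assert (E : minus (T h (F t)) (F t) = minus (T t (F h)) (F h)).
  { rewrite !HF by lra. rewrite (Rplus_comm h t). vfield. }
  rewrite E.
  set (w := minus (F h) (scal (RtoC h) y)) in *.
  replace (minus (minus (T t (F h)) (F h)) (scal (RtoC h) (minus (T t y) y)))
    with (minus (T t w) w).
  2:{ unfold w. rewrite (linear_minus (T t)), (linear_scal (T t)) by now apply HT.
      vfield. }
  apply Rle_trans with ((B + 1) * norm w).
  - unfold minus. eapply Rle_trans; [apply norm_triangle|].
    rewrite norm_opp. specialize (HB w). lra.
  - apply Rmult_le_compat_l with (r := B + 1) in H; [|lra].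
    replace ((B + 1) * (eps / (B + 1) * h)) with (eps * h) in H
      by (field; lra).
    exact H.
Qed.

(** The averages [F h / h] lie in the domain and tend to [y]: the domain of the
    generator is dense. *)
Lemma generator_domain_approx {V : NormedModule C_AbsRing}
    (T : R -> V -> V) M y F :
  is_C0_semigroup T -> orbit_integral T M y F ->
  forall eps, 0 < eps -> exists x z, generator T x z /\ norm (minus x y) <= eps.
Proof.
  intros HT HI eps Heps. pose proof HI as [_ [HF0 _]].
  destruct (HF0 eps Heps) as [d [Hd H]].
  specialize (H (d / 2) ltac:(lra)).
  exists (scal (RtoC (/ (d / 2))) (F (d / 2))).
  exists (scal (RtoC (/ (d / 2))) (minus (T (d / 2) y) y)). split.
  - apply (generator_scal T _ (F (d / 2)) (minus (T (d / 2) y) y) HT).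
    apply (generator_orbit_integral T M y F (d / 2)); auto; lra.
  - assert (P : 0 < / (d / 2)) by (apply Rinv_0_lt_compat; lra).
    apply (norm_eq_le
      (scal (RtoC (/ (d / 2))) (minus (F (d / 2)) (scal (RtoC (d / 2)) y)))).
    + assert (RtoC (d / 2) <> 0) by (intros E; apply RtoC_inj in E; lra).
      rewrite RtoC_inv by lra. vfield; assumption.
    + rewrite norm_scal_RtoC, Rabs_pos_eq by lra.
      apply Rmult_le_compat_l with (r := / (d / 2)) in H; [|lra].
      replace (/ (d / 2) * (eps * (d / 2))) with eps in H by (field; lra).
      exact H.
Qed.

(** * Inverting the generator of a contractive semigroup *)

Lemma neumann_series_solves {V : NormedModule C_AbsRing} (L : V -> V) (v x : V) :
  is_linear L -> is_series (fun n => Nat.iter n L v) x -> minus x (L x) = v.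
Proof.
  intros HL Hx. set (a := fun n => Nat.iter n L v) in Hx.
  assert (S1 : filterlim (fun n => plus (sum_n a (S n)) (opp (L (sum_n a n))))
                 eventually (locally (plus x (opp (L x))))).
  { refine (filterlim_comp_2 _ _ _ _ _ (filterlim_plus x (opp (L x)))).
    - apply (filterlim_comp _ _ _ S (sum_n a) _ eventually);
        [apply eventually_subseq; intros; lia | exact Hx].
    - exact (filterlim_comp _ _ _ _ opp _ _ _
               (filterlim_comp _ _ _ _ L _ _ _ Hx (linear_cont L x HL))
               (filterlim_opp (L x))). }
  assert (S2 : forall n, v = plus (sum_n a (S n)) (opp (L (sum_n a n)))).
  { induction n as [|n IH].
    - rewrite sum_Sn, !sum_O. unfold a; simpl. vfield.
    - rewrite sum_Sn, (sum_Sn a n), (linear_plus L HL).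
      change (L (a (S n))) with (a (S (S n))).
      etransitivity; [exact IH|]. rewrite (sum_Sn a n). vfield. }
  refine (filterlim_locally_unique (F := eventually) _ _ _ S1 _).
  apply (filterlim_ext (fun _ => v)); [exact S2|].
  apply filterlim_const.
Qed.

Lemma contraction_solve (V : CompleteNormedModule C_AbsRing) (L : V -> V) (v : V) :
  is_linear L -> (forall x, norm (L x) <= / 2 * norm x) ->
  exists x, minus x (L x) = v /\ norm x <= 2 * norm v.
Proof.
  intros HL Hc.
  set (a := fun n => Nat.iter n L v).
  assert (Ha : forall n, norm (a n) <= norm v * (/ 2) ^ n).
  { induction n as [|n IH]; simpl; [lra|].
    eapply Rle_trans; [apply Hc|]. simpl in IH.
    fold (a n). lra. }
  assert (Hg : is_series (fun n => norm v * (/ 2) ^ n) (norm v * / (1 - / 2))).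
  { assert (G : is_series (fun n => (/ 2) ^ n) (/ (1 - / 2)))
      by (apply is_series_geom; rewrite Rabs_pos_eq; lra).
    exact (is_series_scal_l (V := R_NormedModule) (norm v) _ _ G). }
  destruct (ex_series_le a _ Ha (ex_intro _ _ Hg)) as [x Hx].
  exists x. split; [exact (neumann_series_solves L v x HL Hx)|].
  replace (2 * norm v) with (norm v * / (1 - / 2)) by field.
  apply (filterlim_le (F := eventually) (fun n => norm (sum_n a n))
           (sum_n (fun k => norm v * (/ 2) ^ k))
           (norm x) (norm v * / (1 - / 2))).
  - exists O. intros n _. unfold sum_n.
    eapply Rle_trans; [exact (norm_sum_n_m (K := C_AbsRing) (V := V) a 0 n)|].
    now apply sum_n_m_le.
  - exact (filterlim_comp _ _ _ _ norm _ _ _ Hx (filterlim_norm x)).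
  - exact Hg.
Qed.

Lemma contraction_fixed_zero {V : NormedModule C_AbsRing} (L : V -> V) x :
  (forall x, norm (L x) <= / 2 * norm x) -> L x = x -> x = zero.
Proof.
  intros Hc E. apply norm_eq_zero. specialize (Hc x). rewrite E in Hc.
  pose proof (norm_ge_0 x). lra.
Qed.

(** The vector [x] is the integral of the orbit of [y] over all positive times;
    describing it as the sum of the [T (n tau) (F tau)] avoids an improper
    integral. *)
Lemma contraction_generator_solve {V : NormedModule C_AbsRing}
    (T : R -> V -> V) M tau y F x :
  is_C0_semigroup T -> orbit_integral T M y F -> 0 <= tau ->
  (forall z, norm (T tau z) <= / 2 * norm z) ->
  minus x (T tau x) = F tau -> generator T x (opp y).
Proof.
  intros HT [HF [HF0 _]] Htau Hc Hx.
  assert (LT : forall t, 0 <= t -> is_linear (T t)) by apply HT.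
  assert (E : forall h, 0 <= h -> minus (T h x) x = opp (F h)).
  { intros h Hh. apply minus_zero_eq.
    apply (contraction_fixed_zero (T tau)); [exact Hc|].
    assert (E0 : T h (F tau) = minus (T h x) (T tau (T h x))).
    { rewrite <- Hx, (linear_minus (T h)) by auto. f_equal.
      rewrite <- !(semigroup_plus _ HT) by lra. now rewrite Rplus_comm. }
    assert (E1 : minus (T h (F tau)) (F tau) = minus (T tau (F h)) (F h)).
    { rewrite !HF by lra. rewrite (Rplus_comm h tau). vfield. }
    rewrite E0 in E1.
    assert (E2 : opp (F h) = scal (RtoC (-1)) (F h)) by vfield.
    rewrite E2, !(linear_minus (T tau)), (linear_scal (T tau)) by (apply LT; lra).
    apply minus_zero_eq.
    assert (E3 : minus (minus (minus (T h x) (T tau (T h x))) (F tau))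
                   (minus (T tau (F h)) (F h)) = zero)
      by (rewrite E1; vfield).
    rewrite <- Hx in E3.
    transitivity (opp (minus (minus (minus (T h x) (T tau (T h x)))
      (minus x (T tau x))) (minus (T tau (F h)) (F h)))); [vfield|].
    rewrite E3. vfield. }
  apply generator_iff. intros eps Heps.
  destruct (HF0 eps Heps) as [d [Hd H]]. exists d; split; [exact Hd|].
  intros h Hh. rewrite E by lra.
  replace (minus (opp (F h)) (scal (RtoC h) (opp y))) with
    (opp (minus (F h) (scal (RtoC h) y))) by vfield.
  rewrite norm_opp. now apply H.
Qed.

Lemma contraction_generator_surj (V : CompleteNormedModule C_AbsRing)
    (T : R -> V -> V) M tau (y : V) :
  is_C0_semigroup T -> 1 <= M -> bounded_by M T -> 0 <= tau ->
  (forall x, norm (T tau x) <= / 2 * norm x) ->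
  exists x, generator T x (opp y) /\ norm x <= 2 * (tau * M) * norm y.
Proof.
  intros HT M1 HM Htau Hc.
  destruct (orbit_integral_exists V T M y HT M1 HM) as [F HF].
  destruct (contraction_solve V (T tau) (F tau)) as [x [Hx Hxn]];
    [now apply HT | exact Hc |].
  exists x. split.
  - exact (contraction_generator_solve T M tau y F x HT HF Htau Hc Hx).
  - destruct HF as [_ [_ HFn]].
    rewrite 2!Rmult_assoc, <- Rmult_assoc with (r1 := tau).
    apply Rle_trans with (1 := Hxn).
    apply Rmult_le_compat_l; [lra | now apply HFn].
Qed.

(** * Points of the unit circle *)

Definition cis (theta : R) : C := (cos theta, sin theta).

Lemma cis_0 : cis 0 = RtoC 1.
Proof. unfold cis. now rewrite cos_0, sin_0. Qed.

Lemma cis_plus a b : cis (a + b) = (cis a * cis b)%C.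
Proof.
  unfold cis, Cmult; simpl. rewrite cos_plus, sin_plus.
  apply injective_projections; simpl; ring.
Qed.

Lemma Cmod_cis a : Cmod (cis a) = 1.
Proof.
  unfold Cmod, cis; simpl.
  replace (_ + _) with 1; [apply sqrt_1|].
  pose proof (sin2_cos2 a) as H. unfold Rsqr in H. lra.
Qed.

Lemma Cconj_cis a : Cconj (cis a) = cis (- a).
Proof. unfold Cconj, cis; simpl. now rewrite cos_neg, sin_neg. Qed.

Lemma Rabs_sin_le x : Rabs (sin x) <= Rabs x.
Proof.
  assert (P : forall y, 0 <= y -> Rabs (sin y) <= y).
  { intros y Hy. destruct (Req_dec y 0) as [->|Hy0].
    - rewrite sin_0, Rabs_R0. lra.
    - destruct (Rle_dec y 1) as [l|l].
      + pose proof PI2_1. rewrite Rabs_pos_eq.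
        * apply Rlt_le, sin_lt_x. lra.
        * apply sin_ge_0; lra.
      + pose proof (SIN_bound y). apply Rle_trans with 1; [|lra].
        apply Rabs_le. lra. }
  destruct (Rle_dec 0 x) as [l|l].
  - rewrite (Rabs_pos_eq x) by lra. now apply P.
  - rewrite (Rabs_left1 x) by lra. rewrite <- Rabs_Ropp, <- sin_neg.
    apply P. lra.
Qed.

Lemma cos_half_angle a : cos a = 1 - 2 * (sin (a / 2)) ^ 2.
Proof.
  replace a with (2 * (a / 2)) at 1 by field. rewrite cos_2a_sin. ring.
Qed.

Lemma Cmod_cis_minus_1_le a : Cmod (cis a - 1) <= Rabs a.
Proof.
  unfold Cmod, cis; simpl. rewrite <- sqrt_Rsqr_abs. apply sqrt_le_1_alt.
  pose proof (sin2_cos2 a) as H. unfold Rsqr in *.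
  apply Rle_trans with (2 - 2 * cos a); [nra|].
  rewrite cos_half_angle.
  pose proof (Rabs_sin_le (a / 2)) as S.
  apply Rsqr_le_abs_1 in S. unfold Rsqr in S. nra.
Qed.

(** The derivative of [cis (s h)] at [h = 0], in the form in which [generator_iff]
    measures derivatives. *)
Lemma cis_derivative s :
  forall eps, 0 < eps -> exists delta, 0 < delta /\ forall h, 0 < h < delta ->
    Cmod (cis (s * h) - 1 - Ci * RtoC s * RtoC h) <= eps * h.
Proof.
  intros eps Heps.
  assert (P : 0 < Rabs s + 1) by (pose proof (Rabs_pos s); lra).
  assert (He : 0 < eps / (2 * (Rabs s + 1))) by (apply Rdiv_lt_0_compat; lra).
  destruct (derivable_pt_lim_sin_0 _ He) as [d Hd].
  pose proof (cond_pos d) as d0.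
  set (m := Rmin (d / (Rabs s + 1)) (eps / ((Rabs s + 1) * (Rabs s + 1)))).
  assert (Hm : 0 < m).
  { apply Rmin_pos; apply Rdiv_lt_0_compat; nra. }
  exists m; split; [exact Hm|]. intros h Hh.
  assert (H1 : h * (Rabs s + 1) < d).
  { apply Rlt_le_trans with (m * (Rabs s + 1)); [apply Rmult_lt_compat_r; lra|].
    replace (pos d) with (d / (Rabs s + 1) * (Rabs s + 1)) by (field; lra).
    apply Rmult_le_compat_r; [lra | apply Rmin_l]. }
  assert (H2 : h * ((Rabs s + 1) * (Rabs s + 1)) < eps).
  { apply Rlt_le_trans with (m * ((Rabs s + 1) * (Rabs s + 1)));
      [apply Rmult_lt_compat_r; nra|].
    replace eps with (eps / ((Rabs s + 1) * (Rabs s + 1)) *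
      ((Rabs s + 1) * (Rabs s + 1))) by (field; lra).
    apply Rmult_le_compat_r; [nra | apply Rmin_r]. }
  pose proof (Rabs_pos s) as s0.
  assert (Ea : Rabs (s * h) = Rabs s * h)
    by (rewrite Rabs_mult, (Rabs_pos_eq h); lra).
  assert (Hs : Rabs (sin (s * h) - s * h) <= eps / 2 * h).
  { destruct (Req_dec (s * h) 0) as [->|n0].
    - rewrite sin_0, Rminus_0_r, Rabs_R0. nra.
    - specialize (Hd (s * h) n0 ltac:(rewrite Ea; nra)).
      rewrite Rplus_0_l, sin_0, Rminus_0_r in Hd.
      replace (sin (s * h) - s * h) with
        ((sin (s * h) / (s * h) - 1) * (s * h)) by (field; split; intros ->; apply n0; ring).
      rewrite Rabs_mult, Ea.
      apply Rle_trans with (eps / (2 * (Rabs s + 1)) * (Rabs s * h)).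
      + apply Rmult_le_compat_r; [nra | lra].
      + apply Rle_trans with (eps / (2 * (Rabs s + 1)) * ((Rabs s + 1) * h)).
        * apply Rmult_le_compat_l; nra.
        * right. field. lra. }
  assert (Hc : Rabs (cos (s * h) - 1) <= eps / 2 * h).
  { rewrite cos_half_angle.
    pose proof (Rabs_sin_le (s * h / 2)) as S.
    apply Rsqr_le_abs_1 in S. rewrite Rsqr_pow2 in S.
    rewrite Rabs_left1 by nra.
    assert (Rsqr (s * h / 2) = (Rabs s * h) * (Rabs s * h) / 4).
    { rewrite <- Ea. rewrite <- Rabs_mult, Rabs_pos_eq by nra.
      unfold Rsqr. field. }
    assert (Rabs s * h * (Rabs s * h) <= eps * h).
    { replace (Rabs s * h * (Rabs s * h)) with (h * (Rabs s * Rabs s) * h)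
        by ring.
      apply Rmult_le_compat_r; [lra|]. nra. }
    nra. }
  apply Rle_trans with
    (Rabs (cos (s * h) - 1) + Rabs (sin (s * h) - s * h)); [|lra].
  replace (cis (s * h) - 1 - Ci * s * h)%C with
    (RtoC (cos (s * h) - 1) + Ci * RtoC (sin (s * h) - s * h))%C.
  - eapply Rle_trans; [apply Cmod_triangle|].
    rewrite Cmod_mult, Cmod_Ci, !Cmod_R. lra.
  - unfold cis, RtoC, Ci, Cplus, Cminus, Copp, Cmult; simpl.
    apply injective_projections; simpl; ring.
Qed.

(** * Rotated semigroups *)

(** The semigroup generated by [A - i s]; it turns a statement about the point
    [i s] of the imaginary axis into one about 0. *)
Definition rotate {V : NormedModule C_AbsRing} (s : R) (T : R -> V -> V) :
  R -> V -> V := fun t x => scal (cis (- s * t)) (T t x).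

Lemma norm_rotate {V : NormedModule C_AbsRing} s (T : R -> V -> V) t x :
  norm (rotate s T t x) = norm (T t x).
Proof. unfold rotate. rewrite norm_scal_C, Cmod_cis. ring. Qed.

Lemma bounded_by_rotate {V : NormedModule C_AbsRing} s (T : R -> V -> V) M :
  bounded_by M T -> bounded_by M (rotate s T).
Proof. intros HM t x Ht. rewrite norm_rotate. now apply HM. Qed.

Lemma C0_semigroup_rotate {V : NormedModule C_AbsRing} s (T : R -> V -> V) :
  is_C0_semigroup T -> is_C0_semigroup (rotate s T).
Proof.
  intros HT. split.
  - intros t Ht. pose proof (semigroup_linear _ HT t Ht) as L. split.
    + intros x y. unfold rotate. rewrite (linear_plus _ L). vfield.
    + intros k x. unfold rotate. rewrite (linear_scal _ L). vfield.
    + destruct (linear_norm _ L) as [B [B0 HB]]. exists B; split; [exact B0|].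
      intros x. rewrite norm_rotate. apply HB.
  - intros x. unfold rotate.
    rewrite Rmult_0_r, cis_0, (semigroup_0 _ HT). vfield.
  - intros a b x Ha Hb. unfold rotate.
    rewrite (semigroup_plus _ HT) by assumption.
    rewrite (linear_scal (T a)) by now apply HT.
    rewrite Rmult_plus_distr_l, cis_plus. vfield.
  - intros x. apply (filterlim_at_right_0 (V := V)). intros eps Heps.
    pose proof (semigroup_continuous _ HT x) as H.
    rewrite (filterlim_at_right_0 (V := V)) in H.
    destruct (H (eps / 2)) as [d [Hd K]]; [lra|].
    assert (N : 0 <= norm x) by apply norm_ge_0.
    assert (Q : 0 < (Rabs s + 1) * (norm x + 1))
      by (apply Rmult_lt_0_compat; pose proof (Rabs_pos s); lra).
    exists (Rmin d (eps / 2 / ((Rabs s + 1) * (norm x + 1)))). split.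
    + apply Rmin_pos; [exact Hd|]. apply Rdiv_lt_0_compat; lra.
    + intros h [h0 Hh].
      pose proof (Rlt_le_trans _ _ _ Hh (Rmin_l _ _)) as h1.
      pose proof (Rlt_le_trans _ _ _ Hh (Rmin_r _ _)) as h2.
      specialize (K h (conj h0 h1)).
      unfold rotate.
      apply Rle_lt_trans with (norm
        (plus (scal (cis (- s * h)) (minus (T h x) x))
              (scal (cis (- s * h) - 1)%C x)));
        [apply Req_le; f_equal; vfield|].
      eapply Rle_lt_trans; [apply norm_triangle_C|].
      rewrite !norm_scal_C, Cmod_cis.
      assert (Hs : Cmod (cis (- s * h) - 1) * norm x <= eps / 2).
      { apply Rmult_lt_compat_r with (r := (Rabs s + 1) * (norm x + 1)) in h2;
          [|exact Q].
        replace (eps / 2 / ((Rabs s + 1) * (norm x + 1)) *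
          ((Rabs s + 1) * (norm x + 1))) with (eps / 2) in h2
          by (field; pose proof (Rabs_pos s); lra).
        apply Rlt_le, Rle_lt_trans with (2 := h2).
        rewrite <- Rmult_assoc. apply Rmult_le_compat;
          [apply Cmod_ge_0 | exact N | | lra].
        eapply Rle_trans; [apply Cmod_cis_minus_1_le|].
        rewrite Rabs_mult, Rabs_Ropp, (Rabs_pos_eq h) by lra.
        pose proof (Rabs_pos s). nra. }
      lra.
Qed.

Lemma generator_rotate {V : NormedModule C_AbsRing} s (T : R -> V -> V) x y :
  generator T x y ->
  generator (rotate s T) x (minus y (scal (Ci * RtoC s)%C x)).
Proof.
  rewrite !generator_iff. intros H eps Heps.
  assert (Nx : 0 <= norm x) by apply norm_ge_0.
  assert (Ny : 0 <= norm y) by apply norm_ge_0.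
  pose proof (Rabs_pos s) as s0.
  destruct (H (eps / 3)) as [d1 [Hd1 H1]]; [lra|].
  destruct (cis_derivative (- s) (eps / 3 / (norm x + 1))) as [d2 [Hd2 H2]].
  { apply Rdiv_lt_0_compat; lra. }
  set (d3 := eps / 3 / ((Rabs s + 1) * (norm y + 1))).
  assert (Q : 0 < (Rabs s + 1) * (norm y + 1))
    by (apply Rmult_lt_0_compat; lra).
  assert (Hd3 : 0 < d3) by (apply Rdiv_lt_0_compat; lra).
  exists (Rmin d1 (Rmin d2 d3)). split; [repeat apply Rmin_pos; assumption|].
  intros h [h0 Hh].
  pose proof (Rlt_le_trans _ _ _ Hh (Rmin_l _ _)) as h1.
  pose proof (Rlt_le_trans _ _ _ Hh (Rmin_r _ _)) as h23.
  pose proof (Rlt_le_trans _ _ _ h23 (Rmin_l _ _)) as h2.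
  pose proof (Rlt_le_trans _ _ _ h23 (Rmin_r _ _)) as h3.
  specialize (H1 h (conj h0 h1)). specialize (H2 h (conj h0 h2)).
  unfold rotate. set (c := cis (- s * h)) in *.
  (* product rule for the phase and the orbit *)
  apply (norm_eq_le (plus (scal c (minus (minus (T h x) x) (scal (RtoC h) y)))
    (plus (scal (RtoC h * (c - 1))%C y)
          (scal (c - 1 - Ci * RtoC (- s) * RtoC h)%C x)))).
  { rewrite RtoC_opp. vfield. }
  assert (C3 : h * Cmod (c - 1) * norm y <= eps / 3 * h).
  { replace (h * Cmod (c - 1) * norm y) with ((Cmod (c - 1) * norm y) * h)
      by ring.
    apply Rmult_le_compat_r; [lra|].
    apply Rmult_lt_compat_r with (r := (Rabs s + 1) * (norm y + 1)) in h3;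
      [|exact Q].
    replace (d3 * ((Rabs s + 1) * (norm y + 1))) with (eps / 3) in h3
      by (unfold d3; field; lra).
    apply Rlt_le, Rle_lt_trans with (2 := h3).
    rewrite <- Rmult_assoc. apply Rmult_le_compat;
      [apply Cmod_ge_0 | exact Ny | | lra].
    eapply Rle_trans; [apply Cmod_cis_minus_1_le|].
    rewrite Rabs_mult, Rabs_Ropp, (Rabs_pos_eq h) by lra. nra. }
  assert (C2 : Cmod (c - 1 - Ci * RtoC (- s) * RtoC h) * norm x <= eps / 3 * h).
  { apply Rle_trans with (eps / 3 / (norm x + 1) * h * (norm x + 1)).
    - apply Rmult_le_compat; [apply Cmod_ge_0 | exact Nx | exact H2 | lra].
    - right. field. lra. }
  eapply Rle_trans; [apply norm_triangle_C|].
  eapply Rle_trans; [apply Rplus_le_compat_l, norm_triangle_C|].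
  rewrite !norm_scal_C, Cmod_mult, Cmod_R, (Rabs_pos_eq h) by lra.
  unfold c at 1. rewrite Cmod_cis. lra.
Qed.

Lemma generator_ext {V : NormedModule C_AbsRing} (T T' : R -> V -> V) x y :
  (forall t, T t x = T' t x) -> generator T x y -> generator T' x y.
Proof.
  intros E. rewrite !generator_iff. intros H eps Heps.
  destruct (H eps Heps) as [d [Hd K]]. exists d; split; [exact Hd|].
  intros h Hh. rewrite <- E. now apply K.
Qed.

(** The converse inclusion is the same computation for the rotation by [- s],
    which undoes the rotation by [s]. *)
Lemma generator_rotate_iff {V : NormedModule C_AbsRing} s (T : R -> V -> V) x y :
  generator (rotate s T) x y <->
  generator T x (plus y (scal (Ci * RtoC s)%C x)).
Proof.
  split; intros H.
  - apply (generator_rotate (- s)) in H.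
    replace (plus y (scal (Ci * RtoC s)%C x)) with
      (minus y (scal (Ci * RtoC (- s))%C x)) by (rewrite RtoC_opp; vfield).
    revert H. apply generator_ext. intros t. unfold rotate.
    assert (E : (cis (- - s * t) * cis (- s * t))%C = RtoC 1).
    { rewrite <- cis_plus, <- cis_0. f_equal. ring. }
    transitivity (scal (cis (- - s * t) * cis (- s * t))%C (T t x)); [vfield|].
    rewrite E. vfield.
  - apply (generator_rotate s) in H.
    replace y with (minus (plus y (scal (Ci * RtoC s)%C x))
                      (scal (Ci * RtoC s)%C x)) by vfield.
    exact H.
Qed.

Lemma shift_graph_generator {V : NormedModule C_AbsRing} s (T : R -> V -> V) x y :
  shift_graph (generator T) (Ci * RtoC s)%C x y <->
  generator (rotate s T) x (opp y).
Proof.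
  rewrite generator_rotate_iff. split.
  - intros [z [Hz <-]].
    refine (eq_ind z (generator T x) Hz _ _). vfield.
  - intros H. exists (plus (opp y) (scal (Ci * RtoC s)%C x)).
    split; [exact H|]. vfield.
Qed.

(** * Exponential stability implies bounded resolvents *)

Lemma resolvent_spec (X : CompleteNormedModule C_AbsRing) (A : X -> X -> Prop)
    lambda y :
  resolvent_set A lambda -> shift_graph A lambda (resolvent A lambda y) y.
Proof.
  intros [H _]. unfold resolvent.
  exact (iota_correct (fun x => shift_graph A lambda x y) (H y)).
Qed.

Lemma resolvent_unique (X : CompleteNormedModule C_AbsRing)
    (A : X -> X -> Prop) lambda x y :
  resolvent_set A lambda -> shift_graph A lambda x y ->
  x = resolvent A lambda y.
Proof.
  intros HR H. pose proof (resolvent_spec X A lambda y HR) as H'.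
  destruct HR as [HR _]. destruct (HR y) as [z [_ Hz]].
  now rewrite <- (Hz _ H), <- (Hz _ H').
Qed.

(** For a linear graph, trivial kernel and bounded solvability suffice: the
    solution is unique, and uniqueness makes the solution map linear. *)
Lemma resolvent_set_intro (X : CompleteNormedModule C_AbsRing)
    (A : X -> X -> Prop) lambda K :
  0 < K ->
  (forall x y x' y', shift_graph A lambda x y -> shift_graph A lambda x' y' ->
     shift_graph A lambda (plus x x') (plus y y')) ->
  (forall a x y, shift_graph A lambda x y ->
     shift_graph A lambda (scal a x) (scal a y)) ->
  (forall x, shift_graph A lambda x zero -> x = zero) ->
  (forall y, exists x, shift_graph A lambda x y /\ norm x <= K * norm y) ->
  resolvent_set A lambda /\
  forall y, norm (resolvent A lambda y) <= K * norm y.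
Proof.
  intros K0 Hp Hs H0 Hex.
  assert (Hu : forall x x' y, shift_graph A lambda x y ->
            shift_graph A lambda x' y -> x = x').
  { intros x x' y H H'. apply minus_zero_eq, H0.
    pose proof (Hp _ _ _ _ H (Hs (RtoC (-1)) _ _ H')) as P.
    refine (eq_ind _ (shift_graph A lambda _)
      (eq_ind _ (fun w => shift_graph A lambda w _) P _ _) _ _); vfield. }
  assert (H1 : forall y, exists! x, shift_graph A lambda x y).
  { intros y. destruct (Hex y) as [x [Hx _]]. exists x; split; [exact Hx|].
    intros x' Hx'. now apply (Hu _ _ y). }
  assert (Hr : forall y, shift_graph A lambda (resolvent A lambda y) y).
  { intros y. exact (iota_correct (fun x => shift_graph A lambda x y) (H1 y)). }
  assert (Hn : forall y, norm (resolvent A lambda y) <= K * norm y).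
  { intros y. destruct (Hex y) as [x [Hx Hxn]].
    now rewrite (Hu _ _ y (Hr y) Hx). }
  split; [split|]; [exact H1| |exact Hn].
  split.
  - intros y y'. apply (Hu _ _ (plus y y')); auto.
  - intros a y. apply (Hu _ _ (scal a y)); auto.
  - exists K; auto.
Qed.

(** The bound does not depend on [s] since rotation preserves all norms. *)
Lemma contraction_resolvent (X : CompleteNormedModule C_AbsRing)
    (T : R -> X -> X) M tau s :
  is_C0_semigroup T -> 1 <= M -> bounded_by M T -> 0 < tau ->
  (forall x, norm (T tau x) <= / 2 * norm x) ->
  resolvent_set (generator T) (Ci * RtoC s)%C /\
  forall y, norm (resolvent (generator T) (Ci * RtoC s)%C y) <=
            2 * (tau * M) * norm y.
Proof.
  intros HT M1 HM Htau Hc.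
  pose proof (C0_semigroup_rotate s T HT) as HS.
  pose proof (bounded_by_rotate s T M HM) as HSM.
  assert (HSc : forall x, norm (rotate s T tau x) <= / 2 * norm x).
  { intros x. rewrite (norm_rotate (V := X)). apply Hc. }
  assert (0 < tau * M) by (apply Rmult_lt_0_compat; lra).
  apply resolvent_set_intro; [lra| | | |].
  - intros x y x' y' H1 H2.
    apply (shift_graph_generator (V := X)) in H1, H2.
    apply (shift_graph_generator (V := X)).
    refine (eq_ind _ (generator _ _) (generator_plus _ _ _ _ _ HS H1 H2) _ _).
    vfield.
  - intros a x y H1.
    apply (shift_graph_generator (V := X)) in H1.
    apply (shift_graph_generator (V := X)).
    refine (eq_ind _ (generator _ _) (generator_scal _ a _ _ HS H1) _ _).
    vfield.
  - intros x H1.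
    apply (shift_graph_generator (V := X)) in H1.
    pose proof (eq_ind _ (generator (rotate s T) x) H1 zero opp_zero) as H2.
    apply (contraction_fixed_zero (V := X) (rotate s T tau)); [exact HSc|].
    exact (generator_zero_fixed (V := X) (rotate s T) x M HS M1 HSM H2 tau
             (Rlt_le _ _ Htau)).
  - intros y.
    destruct (contraction_generator_surj X (rotate s T) M tau y HS M1 HSM
                (Rlt_le _ _ Htau) HSc) as [x [Hx Hn]].
    exists x. split; [now apply (shift_graph_generator (V := X)) | exact Hn].
Qed.

Lemma exponentially_stable_contraction {V : NormedModule C_AbsRing}
    (T : R -> V -> V) :
  is_C0_semigroup T -> exponentially_stable T ->
  exists tau, 0 < tau /\ forall x, norm (T tau x) <= / 2 * norm x.
Proof.
  intros HT [w [M [w0 [M1 H]]]].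
  set (tau := (ln 2 + ln M) / w).
  assert (L2 : 0 < ln 2) by (rewrite <- ln_1; apply ln_increasing; lra).
  assert (LM : 0 <= ln M).
  { rewrite <- ln_1. destruct (Req_dec M 1) as [->|n]; [lra|].
    apply Rlt_le, ln_increasing; lra. }
  assert (Ht : 0 < tau) by (apply Rdiv_lt_0_compat; lra).
  exists tau; split; [exact Ht|]. intros x.
  pose proof (op_norm_bound (T tau) (M * exp (- w * tau))
    (semigroup_linear _ HT tau (Rlt_le _ _ Ht)) (H tau (Rlt_le _ _ Ht)) x) as B.
  replace (- w * tau) with (- ln 2 + - ln M) in B by (unfold tau; field; lra).
  rewrite exp_plus, !exp_Ropp, !exp_ln in B by lra.
  replace (M * (/ 2 * / M)) with (/ 2) in B by (field; lra).
  exact B.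
Qed.

(** * The finite Fourier transform *)

Lemma sum_n_single {G : AbelianMonoid} (u : nat -> G) i n :
  (i <= n)%nat -> (forall j, j <> i -> u j = zero) -> sum_n u n = u i.
Proof.
  intros Hi Hu. induction n as [|n IH].
  - replace i with O by lia. apply sum_O.
  - rewrite sum_Sn. destruct (Nat.eq_dec i (S n)) as [->|ne].
    + replace (sum_n u n) with (zero : G); [apply plus_zero_l|].
      rewrite (sum_n_ext_loc u (fun _ => zero)) by (intros; apply Hu; lia).
      clear. induction n as [|n IH]; [now rewrite sum_O|].
      now rewrite sum_Sn, <- IH, plus_zero_l.
    + rewrite IH by lia. rewrite (Hu (S n)) by lia. apply plus_zero_r.
Qed.

Lemma sum_n_periodic_shift {G : AbelianGroup} (u : nat -> G) n :
  u (S n) = u O -> sum_n (fun j => u (S j)) n = sum_n u n.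
Proof.
  intros Hu.
  assert (E : forall m, plus (u O) (sum_n (fun j => u (S j)) m) =
                        plus (sum_n u m) (u (S m))).
  { induction m as [|m IH]; [now rewrite !sum_O|].
    now rewrite !sum_Sn, plus_assoc, IH. }
  specialize (E n). rewrite Hu, plus_comm in E.
  now apply plus_reg_r in E.
Qed.

(** Angle between consecutive [n + 1]-st roots of unity; sums [sum_n _ n] have
    [n + 1] terms. *)
Definition mesh (n : nat) : R := 2 * PI / INR (S n).

Lemma cis_2PI_nat m : cis (2 * PI * INR m) = RtoC 1.
Proof.
  unfold cis. pose proof (cos_period 0 m) as Hc. pose proof (sin_period 0 m) as Hs.
  replace (0 + 2 * INR m * PI) with (2 * PI * INR m) in Hc, Hs by ring.
  now rewrite Hc, Hs, cos_0, sin_0.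
Qed.

Lemma INR_S_pos n : 0 < INR (S n).
Proof. apply lt_0_INR. lia. Qed.

Lemma cis_mesh_period n m : cis (mesh n * INR (S n) * INR m) = RtoC 1.
Proof.
  rewrite <- (cis_2PI_nat m). f_equal. unfold mesh. field.
  pose proof (INR_S_pos n). lra.
Qed.

Lemma cis_geometric_sum a n :
  ((cis a - 1) * sum_n (fun k => cis (a * INR k)) n = cis (a * INR (S n)) - 1)%C.
Proof.
  induction n as [|n IH].
  - rewrite sum_O. simpl. rewrite Rmult_0_r, Rmult_1_r, cis_0. ring.
  - rewrite sum_Sn. change (plus ?x ?y) with (Cplus x y).
    rewrite Cmult_plus_distr_l, IH, (S_INR (S n)), Rmult_plus_distr_l, Rmult_1_r,
      (cis_plus (a * INR (S n)) a). ring.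
Qed.

Lemma cis_neq_1 a : 0 < a < 2 * PI -> cis a <> RtoC 1.
Proof.
  intros Ha E. apply (f_equal fst) in E. simpl in E.
  rewrite cos_half_angle in E.
  assert (0 < sin (a / 2)) by (apply sin_gt_0; lra). nra.
Qed.

Lemma roots_of_unity_orthogonal n i j :
  (i <= n)%nat -> (j <= n)%nat -> i <> j ->
  sum_n (fun k => cis (mesh n * (INR j - INR i) * INR k)) n = RtoC 0.
Proof.
  intros Hi Hj ne. set (a := mesh n * (INR j - INR i)).
  pose proof (INR_S_pos n) as Hn. pose proof PI_RGT_0 as HPI.
  assert (D : forall d, (0 < d <= n)%nat -> 0 < mesh n * INR d < 2 * PI).
  { intros d [d0 dn]. apply lt_INR in d0. simpl in d0.
    assert (INR d < INR (S n)) by (apply lt_INR; lia).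
    assert (E : 2 * PI = mesh n * INR (S n)) by (unfold mesh; field; lra).
    assert (0 < mesh n) by (apply Rdiv_lt_0_compat; lra).
    rewrite E. split; nra. }
  assert (H1 : cis a <> RtoC 1 /\ cis (a * INR (S n)) = RtoC 1).
  { destruct (Nat.lt_total i j) as [l|[e|l]]; [|lia|].
    - unfold a. rewrite <- minus_INR by lia. split.
      + apply cis_neq_1, D. lia.
      + rewrite <- (cis_mesh_period n (j - i)). f_equal. ring.
    - assert (Ea : a = - (mesh n * INR (i - j)))
        by (unfold a; rewrite minus_INR by lia; ring).
      rewrite Ea. split.
      + intros E. apply (cis_neq_1 (mesh n * INR (i - j))); [apply D; lia|].
        rewrite <- Cconj_cis in E. rewrite <- (Cconj_conj (cis _)), E.
        unfold Cconj, RtoC; simpl. now rewrite Ropp_0.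
      + replace (- (mesh n * INR (i - j)) * INR (S n)) with
          (- (mesh n * INR (S n) * INR (i - j))) by ring.
        rewrite <- Cconj_cis, cis_mesh_period.
        unfold Cconj, RtoC; simpl. now rewrite Ropp_0. }
  destruct H1 as [H1 H2].
  pose proof (cis_geometric_sum a n) as G. rewrite H2 in G.
  assert (Hz : (cis a - 1)%C <> RtoC 0).
  { intros E. apply H1. replace (cis a) with (cis a - 1 + 1)%C by ring.
    rewrite E. ring. }
  set (z := sum_n (fun k => cis (a * INR k)) n) in *.
  destruct (Ceq_dec z 0) as [e|Hne]; [exact e|].
  exfalso. apply (Cmult_neq_0 _ _ Hz Hne). rewrite G. ring.
Qed.

Lemma sum_n_one n : sum_n (fun _ => RtoC 1) n = RtoC (INR (S n)).
Proof.
  induction n as [|n IH]; [now rewrite sum_O|].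
  rewrite sum_Sn, IH, (S_INR (S n)), RtoC_plus. reflexivity.
Qed.

Lemma RtoC_sum_n (f : nat -> R) n :
  RtoC (sum_n f n) = sum_n (fun k => RtoC (f k)) n.
Proof.
  induction n as [|n IH]; [now rewrite !sum_O|].
  rewrite !sum_Sn, <- IH. apply RtoC_plus.
Qed.

Definition dft {V : ModuleSpace C_Ring} (n : nat) (v : nat -> V) (k : nat) : V :=
  sum_n (fun j => scal (cis (- (mesh n * INR j * INR k))) (v j)) n.

Lemma inner_sum_sum {V : NormedModule C_AbsRing} (inner : V -> V -> C)
    (u v : nat -> V) n m :
  is_inner_product V inner ->
  inner (sum_n u n) (sum_n v m) =
  sum_n (fun i => sum_n (fun j => inner (u i) (v j)) m) n.
Proof.
  intros Hi.
  assert (E : forall x, inner x (sum_n v m) = sum_n (fun j => inner x (v j)) m).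
  { intros x. induction m as [|m IH]; [now rewrite !sum_O|].
    rewrite !sum_Sn, <- IH.
    rewrite (inner_conj _ _ Hi), (inner_plus_l _ _ Hi), Cplus_conj.
    now rewrite <- !(inner_conj _ _ Hi). }
  induction n as [|n IH]; [now rewrite !sum_O, E|].
  rewrite !sum_Sn, <- IH, <- E. apply (inner_plus_l _ _ Hi).
Qed.

Lemma inner_scal_scal {V : NormedModule C_AbsRing} (inner : V -> V -> C) a b x y :
  is_inner_product V inner ->
  inner (scal a x) (scal b y) = (a * Cconj b * inner x y)%C.
Proof.
  intros Hi.
  transitivity (a * inner x (scal b y))%C;
    [exact (inner_scal_l _ _ Hi a x (scal b y))|].
  rewrite (inner_conj _ _ Hi (scal b y)).
  transitivity (a * Cconj (b * inner y x))%C;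
    [do 2 f_equal; exact (inner_scal_l _ _ Hi b y x)|].
  rewrite Cmult_conj, <- (inner_conj _ _ Hi). ring.
Qed.

(** Expanding the inner products and summing over the frequency first, only the
    diagonal terms survive, by orthogonality of the roots of unity. *)
Lemma parseval {V : NormedModule C_AbsRing} (inner : V -> V -> C) n
    (v : nat -> V) :
  is_inner_product V inner ->
  sum_n (fun k => norm (dft n v k) ^ 2) n =
  INR (S n) * sum_n (fun j => norm (v j) ^ 2) n.
Proof.
  intros Hi. apply RtoC_inj. rewrite RtoC_mult, !RtoC_sum_n.
  transitivity (sum_n (fun k => sum_n (fun i => sum_n (fun j =>
    (cis (mesh n * (INR j - INR i) * INR k) * inner (v i) (v j))%C) n) n) n).
  { apply sum_n_ext. intros k. rewrite <- (inner_norm _ _ Hi).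
    unfold dft. rewrite (inner_sum_sum inner _ _ _ _ Hi).
    apply sum_n_ext. intros i. apply sum_n_ext. intros j.
    rewrite (inner_scal_scal inner _ _ _ _ Hi), Cconj_cis, <- cis_plus.
    do 2 f_equal. ring. }
  rewrite sum_n_switch.
  transitivity (sum_n (fun i => (RtoC (INR (S n)) * RtoC (norm (v i) ^ 2))%C) n).
  2:{ exact (sum_n_mult_l (K := C_Ring) (RtoC (INR (S n)))
               (fun i => RtoC (norm (v i) ^ 2)) n). }
  apply sum_n_ext_loc. intros i Hin. rewrite sum_n_switch.
  assert (F : forall j, sum_n (fun k =>
    (cis (mesh n * (INR j - INR i) * INR k) * inner (v i) (v j))%C) n =
    (sum_n (fun k => cis (mesh n * (INR j - INR i) * INR k)) n
     * inner (v i) (v j))%C).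
  { intros j. exact (sum_n_mult_r (K := C_Ring) (inner (v i) (v j)) _ n). }
  rewrite (sum_n_ext_loc _ (fun j => if Nat.eq_dec j i
     then (RtoC (INR (S n)) * RtoC (norm (v i) ^ 2))%C else RtoC 0)).
  - rewrite (sum_n_single _ i n Hin).
    + destruct (Nat.eq_dec i i); [reflexivity | contradiction].
    + intros j Hj. destruct (Nat.eq_dec j i); [contradiction | reflexivity].
  - intros j Hj. rewrite F. destruct (Nat.eq_dec j i) as [->|ne].
    + rewrite (inner_norm _ _ Hi). f_equal.
      rewrite <- sum_n_one. apply sum_n_ext. intros k.
      rewrite <- cis_0. f_equal. ring.
    + rewrite roots_of_unity_orthogonal by auto. exact (Cmult_0_l _).
Qed.

Lemma dft_shift {V : ModuleSpace C_Ring} n (u : nat -> V) k :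
  u (S n) = u O ->
  dft n (fun j => u (S j)) k = scal (cis (mesh n * INR k)) (dft n u k).
Proof.
  intros Hu. unfold dft.
  rewrite <- (sum_n_periodic_shift
    (fun j => scal (cis (- (mesh n * INR j * INR k))) (u j))).
  - etransitivity; [|exact (sum_n_scal_l (K := C_Ring) _ _ n)].
    apply sum_n_ext. intros j.
    replace (- (mesh n * INR j * INR k)) with
      (mesh n * INR k + - (mesh n * INR (S j) * INR k))
      by (rewrite S_INR; ring).
    rewrite cis_plus. vfield.
  - rewrite Hu. f_equal. rewrite Rmult_0_r, Rmult_0_l, Ropp_0, cis_0.
    rewrite <- Cconj_cis, cis_mesh_period.
    unfold Cconj, RtoC; simpl. now rewrite Ropp_0.
Qed.

Lemma dft_plus {V : ModuleSpace C_Ring} n (u v : nat -> V) k :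
  dft n (fun j => plus (u j) (v j)) k = plus (dft n u k) (dft n v k).
Proof.
  etransitivity; [|exact (sum_n_plus _ _ n)].
  apply sum_n_ext. intros j. vfield.
Qed.

Lemma dft_scal {V : ModuleSpace C_Ring} n a (u : nat -> V) k :
  dft n (fun j => scal a (u j)) k = scal a (dft n u k).
Proof.
  etransitivity; [|exact (sum_n_scal_l (K := C_Ring) a _ n)].
  apply sum_n_ext. intros j. vfield.
Qed.

Lemma cis_central_difference a :
  (cis a - cis (- a) = 2 * Ci * RtoC (sin a))%C.
Proof.
  unfold cis. rewrite cos_neg, sin_neg.
  unfold Cminus, Cplus, Copp, Cmult, Ci, RtoC; simpl.
  apply injective_projections; simpl; ring.
Qed.

(** * The discrete energy estimate *)

(** On a periodic grid the Fourier multiplier of the central difference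
    quotient is [i sin (theta k) / h], which lies on the imaginary axis for every
    frequency; so the resolvent bound applies at each frequency without error
    terms, and the finite Parseval identity sums up the results. *)
Lemma central_difference_energy {V : NormedModule C_AbsRing}
    (inner : V -> V -> C) (T : R -> V -> V) K n h (u z : nat -> V) :
  is_inner_product V inner -> is_C0_semigroup T -> 0 <= K -> 0 < h ->
  (forall s x y, shift_graph (generator T) (Ci * RtoC s)%C x y ->
     norm x <= K * norm y) ->
  u (S n) = u O -> u (S (S n)) = u 1%nat ->
  (forall j, generator T (u (S j)) (z j)) ->
  sum_n (fun j => norm (u (S j)) ^ 2) n <=
  K ^ 2 * sum_n (fun j => norm (minus
    (scal (RtoC (/ (2 * h))) (minus (u (S (S j))) (u j))) (z j)) ^ 2) n.
Proof.
  intros Hi HT K0 h0 HK Hu0 Hu1 Hz.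
  set (g := fun j => minus
    (scal (RtoC (/ (2 * h))) (minus (u (S (S j))) (u j))) (z j)).
  set (w := fun j => u (S j)).
  assert (P : forall k, norm (dft n w k) <= K * norm (dft n g k)).
  { intros k. apply (HK (sin (mesh n * INR k) / h)).
    exists (dft n z k). split.
    - apply generator_sum_n; [exact HT|]. intros j.
      apply generator_scal; [exact HT | apply Hz].
    - assert (Eg : dft n g k = plus (plus
        (scal (RtoC (/ (2 * h))) (dft n (fun j => u (S (S j))) k))
        (scal (- RtoC (/ (2 * h)))%C (dft n u k)))
        (scal (- RtoC 1)%C (dft n z k))).
      { rewrite <- !dft_scal, <- !dft_plus. apply sum_n_ext. intros j.
        unfold g. vfield. }
      rewrite Eg.
      assert (E1 : dft n w k = scal (cis (mesh n * INR k)) (dft n u k))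
        by now apply dft_shift.
      assert (E2 : dft n (fun j => u (S (S j))) k =
        scal (cis (mesh n * INR k)) (dft n w k)) by now apply (dft_shift n w).
      assert (E3 : dft n u k = scal (cis (- (mesh n * INR k))) (dft n w k)).
      { rewrite E1.
        transitivity (scal (cis (- (mesh n * INR k)) * cis (mesh n * INR k))%C
          (dft n u k)); [|vfield].
        rewrite <- cis_plus, Rplus_opp_l, cis_0. vfield. }
      rewrite E2, E3.
      set (a := mesh n * INR k) in *.
      transitivity (minus
        (scal (RtoC (/ (2 * h)) * (cis a - cis (- a)))%C (dft n w k))
        (dft n z k)); [|vfield].
      rewrite cis_central_difference.
      replace (RtoC (/ (2 * h)) * (2 * Ci * RtoC (sin a)))%C with
        (Ci * RtoC (sin a / h))%C; [reflexivity|].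
      replace (RtoC (sin a / h)) with (RtoC (/ (2 * h)) * (2 * RtoC (sin a)))%C;
        [ring|].
      rewrite <- !RtoC_mult. f_equal. field. lra. }
  apply Rmult_le_reg_l with (INR (S n)); [apply INR_S_pos|].
  change (sum_n (fun j => norm (u (S j)) ^ 2) n) with
    (sum_n (fun j => norm (w j) ^ 2) n).
  change (fun j => norm (minus _ (z j)) ^ 2) with (fun j => norm (g j) ^ 2).
  rewrite <- (parseval inner n w Hi).
  replace (INR (S n) * (K ^ 2 * sum_n (fun j => norm (g j) ^ 2) n)) with
    (K ^ 2 * (INR (S n) * sum_n (fun j => norm (g j) ^ 2) n)) by ring.
  rewrite <- (parseval inner n g Hi).
  eapply Rle_trans;
    [|right; exact (sum_n_mult_l (K := R_Ring) (K ^ 2)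
        (fun k => norm (dft n g k) ^ 2) n)].
  apply sum_n_m_le. intros k.
  change (norm (dft n w k) ^ 2 <= K ^ 2 * norm (dft n g k) ^ 2).
  rewrite <- Rpow_mult_distr. apply pow_incr. split; [apply norm_ge_0 | apply P].
Qed.

(** * Decay of orbits from the resolvent bound *)

(** The cut-off in time. A complex weight is allowed, and this one vanishes at
    both ends of the period, has steps of size at most [mesh n], and on a grid of at
    least two points its mean square is exactly 2, by orthogonality. *)
Definition window (n j : nat) : C := (1 - cis (mesh n * INR j))%C.

Lemma window_0 n : window n 0 = RtoC 0.
Proof. unfold window. simpl. rewrite Rmult_0_r, cis_0. ring. Qed.

Lemma window_period n j : window n (S n + j) = window n j.
Proof.
  unfold window. f_equal. rewrite plus_INR, Rmult_plus_distr_l, cis_plus.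
  pose proof (cis_mesh_period n 1) as H. rewrite Rmult_1_r in H. rewrite H.
  f_equal. ring.
Qed.

Lemma mesh_pos n : 0 < mesh n.
Proof.
  pose proof PI_RGT_0. apply Rdiv_lt_0_compat; [lra | apply INR_S_pos].
Qed.

Lemma Cmod_window_step n j : Cmod (window n (S j) - window n j) <= mesh n.
Proof.
  unfold window. rewrite S_INR, Rmult_plus_distr_l, Rmult_1_r, cis_plus.
  set (c := cis (mesh n * INR j)).
  replace (1 - c * cis (mesh n) - (1 - c))%C with (- (c * (cis (mesh n) - 1)))%C
    by ring.
  rewrite Cmod_opp, Cmod_mult. unfold c. rewrite Cmod_cis, Rmult_1_l.
  eapply Rle_trans; [apply Cmod_cis_minus_1_le|].
  right. apply Rabs_pos_eq, Rlt_le, mesh_pos.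
Qed.

Lemma Cmod_window_le n j : Cmod (window n j) <= 2.
Proof.
  unfold window, Cminus. eapply Rle_trans; [apply Cmod_triangle|].
  rewrite Cmod_opp, Cmod_cis, Cmod_1. lra.
Qed.

Lemma window_energy n :
  (1 <= n)%nat ->
  sum_n (fun j => Cmod (window n (S j)) ^ 2) n = 2 * INR (S n).
Proof.
  intros Hn.
  set (f := fun j => cis (mesh n * INR j)).
  assert (Z : sum_n (fun j => f (S j)) n = RtoC 0).
  { rewrite (sum_n_periodic_shift (G := C_AbelianGroup) f).
    - rewrite <- (roots_of_unity_orthogonal n 0 1) by lia.
      apply sum_n_ext. intros k. unfold f. f_equal. simpl. ring.
    - unfold f. pose proof (cis_mesh_period n 1) as H.
      rewrite Rmult_1_r in H. rewrite H. simpl. now rewrite Rmult_0_r, cis_0. }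
  assert (E : forall m, RtoC (sum_n (fun j => Cmod (window n (S j)) ^ 2) m) =
    (2 * RtoC (INR (S m)) - (sum_n (fun j => f (S j)) m +
       Cconj (sum_n (fun j => f (S j)) m)))%C).
  { assert (E1 : forall j, RtoC (Cmod (window n (S j)) ^ 2) =
      (2 - (f (S j) + Cconj (f (S j))))%C).
    { intros j. rewrite Cmod2_conj. unfold window. fold (f (S j)).
      rewrite Cminus_conj.
      replace (Cconj 1) with (RtoC 1)
        by (unfold Cconj, RtoC; simpl; now rewrite Ropp_0).
      transitivity (1 - (f (S j) + Cconj (f (S j))) + f (S j) * Cconj (f (S j)))%C;
        [ring|].
      rewrite <- Cmod2_conj. unfold f at 3. rewrite Cmod_cis.
      replace (1 ^ 2) with 1 by ring. ring. }
    induction m as [|m IH].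
    - rewrite !sum_O, E1. simpl. ring.
    - rewrite !sum_Sn. change (plus ?x ?y) with (Rplus x y) at 1.
      change (plus ?x ?y) with (Cplus x y).
      rewrite RtoC_plus, IH, E1, Cplus_conj, (S_INR (S m)), RtoC_plus. ring. }
  apply RtoC_inj. rewrite E, Z, RtoC_mult.
  unfold Cconj, RtoC; simpl. rewrite Ropp_0.
  change (0, 0) with (RtoC 0). ring.
Qed.

Lemma sum_n_le_loc (f g : nat -> R) n :
  (forall j, (j <= n)%nat -> f j <= g j) -> sum_n f n <= sum_n g n.
Proof.
  intros H. induction n as [|n IH].
  - rewrite !sum_O. now apply H.
  - rewrite !sum_Sn. apply Rplus_le_compat; [|now apply H].
    apply IH. intros j Hj. apply H. lia.
Qed.

(** Expand the orbit around the midpoint [t + h]: [T (t + h) x] is left with the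
    first difference [c - a] of the weights, and [T (t + h) z] with the second
    difference [c - 2 b + a]. The remaining terms are the Taylor remainders
    [T h x - x - h z] and [T h z - z], transported by the semigroup. *)
Lemma weighted_orbit_residual {V : NormedModule C_AbsRing} (T : R -> V -> V) M
    (a b c : C) theta rho t h (x z : V) :
  is_C0_semigroup T -> 1 <= M -> bounded_by M T ->
  0 <= t -> 0 < h -> 0 <= theta -> 0 <= rho ->
  Cmod a <= 2 -> Cmod c <= 2 -> Cmod (b - a) <= theta -> Cmod (c - b) <= theta ->
  norm (minus (minus (T h x) x) (scal (RtoC h) z)) <= rho * h ->
  norm (minus (T h z) z) <= rho ->
  norm (minus (scal (RtoC (/ (2 * h)))
    (minus (scal c (T (t + 2 * h) x)) (scal a (T t x))))
    (scal b (T (t + h) z))) <=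
  theta / h * (M * norm x) + theta * (M * norm z) + 3 * M * rho.
Proof.
  intros HT M1 HM Ht Hh Hth Hrho Ha Hc Hba Hcb Hr Hd.
  set (r := minus (minus (T h x) x) (scal (RtoC h) z)) in *.
  set (d := minus (T h z) z) in *.
  assert (LT : forall s, 0 <= s -> is_linear (T s)) by apply HT.
  assert (S1 : forall v, T t (T h v) = T (t + h) v)
    by (intros v; now rewrite (semigroup_plus _ HT) by lra).
  assert (E2 : T (t + 2 * h) x = T (t + h) (T h x)).
  { rewrite <- (semigroup_plus _ HT) by lra. f_equal. ring. }
  assert (R1 : T (t + h) r =
    minus (minus (T (t + 2 * h) x) (T (t + h) x)) (scal (RtoC h) (T (t + h) z))).
  { rewrite E2. unfold r.
    rewrite !(linear_minus (T (t + h))) by (apply LT; lra).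
    f_equal. f_equal. apply (linear_scal _ (LT (t + h) ltac:(lra))). }
  assert (R0 : T t r =
    minus (minus (T (t + h) x) (T t x)) (scal (RtoC h) (T t z))).
  { rewrite <- S1. unfold r.
    rewrite !(linear_minus (T t)) by (apply LT; lra).
    f_equal. f_equal. apply (linear_scal _ (LT t ltac:(lra))). }
  assert (D0 : T t d = minus (T (t + h) z) (T t z)).
  { rewrite <- S1. unfold d. now rewrite (linear_minus (T t)) by (apply LT; lra). }
  assert (Hne : RtoC h <> RtoC 0) by (intros E; apply RtoC_inj in E; lra).
  apply (norm_eq_le (scal (RtoC (/ (2 * h)))
    (plus (plus (scal ((c - b) + (b - a))%C (T (t + h) x))
                (scal (RtoC h * ((c - b) - (b - a)))%C (T (t + h) z)))
          (plus (scal c (T (t + h) r))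
                (plus (scal (- (RtoC h * a))%C (T t d)) (scal a (T t r))))))).
  { rewrite R1, R0, D0, RtoC_inv, RtoC_mult by lra. vfield; auto. }
  rewrite norm_scal_RtoC, Rabs_pos_eq
    by (apply Rlt_le, Rinv_0_lt_compat; lra).
  apply Rmult_le_reg_l with (2 * h); [lra|].
  rewrite <- Rmult_assoc, Rinv_r, Rmult_1_l by lra.
  assert (B : forall s k w e B, 0 <= s -> Cmod k <= B -> norm w <= e ->
    norm (scal k (T s w)) <= B * (M * e)).
  { intros s k w e B0 Hs Hk Hw. rewrite norm_scal_C.
    apply Rmult_le_compat; [apply Cmod_ge_0 | apply norm_ge_0 | exact Hk |].
    apply Rle_trans with (M * norm w); [now apply HM|].
    apply Rmult_le_compat_l; lra. }
  pose proof (B (t + h) ((c - b) + (b - a))%C x (norm x) (theta + theta)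
    ltac:(lra) ltac:(eapply Rle_trans; [apply Cmod_triangle | lra])
    (Rle_refl _)) as B1.
  pose proof (B (t + h) (RtoC h * ((c - b) - (b - a)))%C z (norm z)
    (h * (theta + theta)) ltac:(lra)) as B2.
  assert (P2 : Cmod (RtoC h * ((c - b) - (b - a))) <= h * (theta + theta)).
  { rewrite Cmod_mult, Cmod_R, Rabs_pos_eq by lra.
    apply Rmult_le_compat_l; [lra|].
    unfold Cminus at 1. eapply Rle_trans; [apply Cmod_triangle|].
    rewrite Cmod_opp. lra. }
  specialize (B2 P2 (Rle_refl _)).
  pose proof (B (t + h) c r (rho * h) 2 ltac:(lra) Hc Hr) as B3.
  assert (P4 : Cmod (- (RtoC h * a)) <= h * 2).
  { rewrite Cmod_opp, Cmod_mult, Cmod_R, Rabs_pos_eq by lra.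
    apply Rmult_le_compat_l; lra. }
  pose proof (B t (- (RtoC h * a))%C d rho (h * 2) Ht P4 Hd) as B4.
  pose proof (B t a r (rho * h) 2 Ht Ha Hr) as B5.
  eapply Rle_trans; [apply norm_triangle_C|].
  eapply Rle_trans; [apply Rplus_le_compat; apply norm_triangle_C|].
  eapply Rle_trans; [apply Rplus_le_compat_l, Rplus_le_compat_l, norm_triangle_C|].
  replace (2 * h * (theta / h * (M * norm x) + theta * (M * norm z) + 3 * M * rho))
    with ((theta + theta) * (M * norm x) + h * (theta + theta) * (M * norm z) +
      (2 * (M * (rho * h)) + (h * 2 * (M * rho) + 2 * (M * (rho * h)))))
    by (field; lra).
  apply Rplus_le_compat; [now apply Rplus_le_compat|].
  apply Rplus_le_compat; [exact B3 | now apply Rplus_le_compat].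
Qed.

(** The energy inequality compares a mean square of at least
    [2 (|T L x| / M) ^ 2] for the windowed orbit with a residual that is bounded
    pointwise. *)
Lemma grid_decay {V : NormedModule C_AbsRing} (inner : V -> V -> C)
    (T : R -> V -> V) M K L n rho (x z : V) :
  is_inner_product V inner -> is_C0_semigroup T -> 1 <= M -> bounded_by M T ->
  0 <= K -> 0 < L -> 0 <= rho -> (1 <= n)%nat ->
  (forall s x y, shift_graph (generator T) (Ci * RtoC s)%C x y ->
     norm x <= K * norm y) ->
  generator T x z ->
  norm (minus (minus (T (L / INR (S n)) x) x) (scal (RtoC (L / INR (S n))) z))
    <= rho * (L / INR (S n)) ->
  norm (minus (T (L / INR (S n)) z) z) <= rho ->
  norm (T L x) <=
  M * (K * (2 * PI / L * (M * norm x) + mesh n * (M * norm z) + 3 * M * rho)).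
Proof.
  intros Hi HT M1 HM K0 L0 Hrho Hn HK Hg Hr Hd.
  set (h := L / INR (S n)) in *.
  pose proof (INR_S_pos n) as N0.
  assert (h0 : 0 < h) by (now apply Rdiv_lt_0_compat).
  (* Reducing times modulo L past the endpoint makes the windowed orbit
     periodic; the orbit itself jumps there, but the weight vanishes. *)
  set (time := fun j => if Nat.leb j (S n) then INR j * h else INR (j - S n) * h).
  assert (time0 : forall j, 0 <= time j).
  { intros j. unfold time.
    destruct (Nat.leb j (S n)); apply Rmult_le_pos; try apply pos_INR; lra. }
  assert (timeE : forall j, (j <= S n)%nat -> time j = INR j * h).
  { intros j Hj. unfold time. now rewrite (proj2 (Nat.leb_le _ _) Hj). }
  set (u := fun j => scal (window n j) (T (time j) x)).
  set (v := fun j => scal (window n (S j)) (T (time (S j)) z)).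
  set (G := 2 * PI / L * (M * norm x) + mesh n * (M * norm z) + 3 * M * rho).
  assert (Eth : mesh n / h = 2 * PI / L)
    by (unfold mesh, h; field; split; lra).
  pose proof (mesh_pos n) as th0.
  assert (Mx : 0 <= M * norm x) by (apply Rmult_le_pos; [lra | apply norm_ge_0]).
  assert (Mz : 0 <= M * norm z) by (apply Rmult_le_pos; [lra | apply norm_ge_0]).
  assert (Q : 0 <= 2 * PI / L) by (rewrite <- Eth; apply Rlt_le, Rdiv_lt_0_compat; lra).
  assert (Gx : 0 <= 2 * PI / L * (M * norm x)) by (apply Rmult_le_pos; lra).
  assert (Gz : 0 <= mesh n * (M * norm z)) by (apply Rmult_le_pos; lra).
  assert (Gr : 0 <= 3 * M * rho) by (apply Rmult_le_pos; lra).
  assert (G0 : 0 <= G) by (unfold G; lra).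
  assert (W1 : window n (S n) = RtoC 0).
  { replace (S n) with (S n + 0)%nat by lia. now rewrite window_period, window_0. }
  assert (W2 : window n (S (S n)) = window n 1).
  { replace (S (S n)) with (S n + 1)%nat by lia. apply window_period. }
  assert (U0 : u O = zero)
    by (unfold u; rewrite window_0; apply (scal_zero_l (K := C_Ring))).
  assert (U1 : u (S n) = zero)
    by (unfold u; rewrite W1; apply (scal_zero_l (K := C_Ring))).
  assert (U2 : u (S (S n)) = u 1%nat).
  { unfold u. rewrite W2. f_equal. f_equal. rewrite (timeE 1%nat) by lia.
    unfold time. rewrite (proj2 (Nat.leb_gt _ _)) by lia.
    now replace (S (S n) - S n)%nat with 1%nat by lia. }
  pose proof (central_difference_energy inner T K n h u v Hi HT K0 h0 HK
    (eq_trans U1 (eq_sym U0)) U2) as E.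
  assert (Hgen : forall j, generator T (u (S j)) (v j)).
  { intros j. apply generator_scal; [exact HT|].
    now apply generator_orbit. }
  specialize (E Hgen).
  assert (Res : forall j, (j <= n)%nat -> norm (minus
    (scal (RtoC (/ (2 * h))) (minus (u (S (S j))) (u j))) (v j)) <= G).
  { intros j Hj. destruct (Nat.eq_dec j n) as [->|ne].
    - (* the step centred at the endpoint, where the weight is 0 and the two
         neighbours come from opposite ends of the orbit *)
      rewrite U2. unfold v. rewrite W1.
      apply (norm_eq_le (scal (RtoC (/ (2 * h))) (minus (u 1%nat) (u n))));
        [vfield|].
      rewrite norm_scal_RtoC, Rabs_pos_eq
        by (apply Rlt_le, Rinv_0_lt_compat; lra).
      assert (B1 : norm (u 1%nat) <= mesh n * (M * norm x)).
      { unfold u. rewrite norm_scal_C.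
        apply Rmult_le_compat; [apply Cmod_ge_0 | apply norm_ge_0 | | now apply HM].
        pose proof (Cmod_window_step n 0) as H. rewrite window_0 in H.
        now replace (window n 1 - 0)%C with (window n 1) in H by ring. }
      assert (Bn : norm (u n) <= mesh n * (M * norm x)).
      { unfold u. rewrite norm_scal_C.
        apply Rmult_le_compat; [apply Cmod_ge_0 | apply norm_ge_0 | | now apply HM].
        pose proof (Cmod_window_step n n) as H. rewrite W1 in H.
        replace (0 - window n n)%C with (- window n n)%C in H by ring.
        now rewrite Cmod_opp in H. }
      apply Rle_trans with (2 * PI / L * (M * norm x)).
      + rewrite <- Eth. apply Rmult_le_reg_l with (2 * h); [lra|].
        rewrite <- Rmult_assoc, Rinv_r, Rmult_1_l by lra.
        replace (2 * h * (mesh n / h * (M * norm x))) with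
          (mesh n * (M * norm x) + mesh n * (M * norm x)) by (field; lra).
        eapply Rle_trans; [apply norm_minus_le|]. now apply Rplus_le_compat.
      + unfold G. lra.
    - unfold G. rewrite <- Eth. unfold u, v.
      rewrite !timeE by lia.
      replace (INR (S (S j)) * h) with (INR j * h + 2 * h)
        by (rewrite !S_INR; ring).
      replace (INR (S j) * h) with (INR j * h + h) by (rewrite S_INR; ring).
      apply weighted_orbit_residual; auto using Cmod_window_le, Cmod_window_step;
        try lra.
      apply Rmult_le_pos; [apply pos_INR | lra]. }
  assert (Up : sum_n (fun j => norm (minus
    (scal (RtoC (/ (2 * h))) (minus (u (S (S j))) (u j))) (v j)) ^ 2) n
    <= INR (S n) * G ^ 2).
  { rewrite <- sum_n_const. apply sum_n_le_loc.
    intros j Hj. apply pow_incr. split; [apply norm_ge_0 | apply Res; lia]. }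
  assert (Low : 2 * INR (S n) * (norm (T L x) / M) ^ 2 <=
    sum_n (fun j => norm (u (S j)) ^ 2) n).
  { rewrite <- (window_energy n Hn).
    eapply Rle_trans.
    - right. symmetry.
      exact (sum_n_mult_r (K := R_Ring) ((norm (T L x) / M) ^ 2)
        (fun j => Cmod (window n (S j)) ^ 2) n).
    - apply sum_n_le_loc. intros j Hj.
      change (Cmod (window n (S j)) ^ 2 * (norm (T L x) / M) ^ 2 <=
              norm (u (S j)) ^ 2).
      rewrite <- Rpow_mult_distr. apply pow_incr. split.
      + apply Rmult_le_pos; [apply Cmod_ge_0|].
        apply Rdiv_le_0_compat; [apply norm_ge_0 | lra].
      + unfold u. rewrite norm_scal_C. apply Rmult_le_compat_l; [apply Cmod_ge_0|].
        apply Rmult_le_reg_l with M; [lra|].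
        replace (M * (norm (T L x) / M)) with (norm (T L x)) by (field; lra).
        assert (Hle : time (S j) <= L).
        { rewrite timeE by lia. replace L with (INR (S n) * h)
            by (unfold h; field; lra).
          apply Rmult_le_compat_r; [lra|]. apply le_INR. lia. }
        replace L with ((L - time (S j)) + time (S j)) at 1 by ring.
        rewrite (semigroup_plus _ HT) by (try apply time0; lra).
        apply HM. lra. }
  assert (F : (norm (T L x) / M) ^ 2 <= (K * G) ^ 2).
  { apply Rmult_le_reg_l with (INR (S n)); [exact N0|].
    apply Rle_trans with (K ^ 2 * (INR (S n) * G ^ 2)).
    - apply Rle_trans with (2 * INR (S n) * (norm (T L x) / M) ^ 2).
      + apply Rmult_le_compat_r; [apply pow2_ge_0 | lra].
      + apply Rle_trans with (1 := Low), Rle_trans with (1 := E).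
        apply Rmult_le_compat_l; [apply pow2_ge_0 | exact Up].
    - right. ring. }
  assert (F' : norm (T L x) / M <= K * G).
  { apply Rsqr_incr_0_var; [now rewrite !Rsqr_pow2|].
    apply Rmult_le_pos; assumption. }
  apply Rmult_le_compat_l with (r := M) in F'; [|lra].
  replace (M * (norm (T L x) / M)) with (norm (T L x)) in F' by (field; lra).
  exact F'.
Qed.

(** Limit of [grid_decay] under refinement: the error terms vanish with the mesh
    while the main term depends on [L] only. *)
Lemma orbit_decay {V : NormedModule C_AbsRing} (inner : V -> V -> C)
    (T : R -> V -> V) M K L (x z : V) :
  is_inner_product V inner -> is_C0_semigroup T -> 1 <= M -> bounded_by M T ->
  0 <= K -> 0 < L ->
  (forall s x y, shift_graph (generator T) (Ci * RtoC s)%C x y ->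
     norm x <= K * norm y) ->
  generator T x z ->
  norm (T L x) <= 2 * PI * M ^ 2 * K / L * norm x.
Proof.
  intros Hi HT M1 HM K0 L0 HK Hg.
  apply le_epsilon. intros e He.
  set (eps := e / (M * K + 1)).
  assert (MK : 0 <= M * K) by (apply Rmult_le_pos; lra).
  assert (He1 : 0 < eps) by (apply Rdiv_lt_0_compat; lra).
  set (rho := eps / (6 * M)).
  assert (Hrho : 0 < rho) by (apply Rdiv_lt_0_compat; lra).
  pose proof Hg as Hg'. rewrite generator_iff in Hg'.
  destruct (Hg' rho Hrho) as [d1 [Hd1 H1]].
  destruct (orbit_continuous_0 T z HT rho Hrho) as [d2 [Hd2 H2]].
  assert (Mz : 0 <= M * norm z) by (apply Rmult_le_pos; [lra | apply norm_ge_0]).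
  pose proof PI_RGT_0 as HPI.
  set (c := 2 * PI * (M * norm z)).
  assert (c0 : 0 <= c) by (apply Rmult_le_pos; lra).
  set (m := Rmin (Rmin d1 d2 / L) (eps / 2 / (c + 1))).
  assert (Hm : 0 < m).
  { apply Rmin_pos; apply Rdiv_lt_0_compat; try lra. now apply Rmin_pos. }
  destruct (archimed_cor1 m Hm) as [n [Hn n0]].
  assert (N0 : 0 < INR n) by (apply lt_0_INR; lia).
  assert (N1 : / INR (S n) < m).
  { apply Rlt_trans with (2 := Hn). apply Rinv_lt_contravar.
    - apply Rmult_lt_0_compat; [exact N0 | apply INR_S_pos].
    - rewrite S_INR. lra. }
  pose proof (Rinv_0_lt_compat _ (INR_S_pos n)) as N2.
  assert (Hh : 0 < L / INR (S n) < Rmin d1 d2).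
  { split; [apply Rmult_lt_0_compat; lra|].
    pose proof (Rlt_le_trans _ _ _ N1 (Rmin_l _ _)) as H.
    apply Rmult_lt_compat_l with (r := L) in H; [|lra].
    replace (L * (Rmin d1 d2 / L)) with (Rmin d1 d2) in H by (field; lra).
    exact H. }
  pose proof (Rmin_l d1 d2). pose proof (Rmin_r d1 d2).
  assert (Hz : mesh n * (M * norm z) <= eps / 2).
  { replace (mesh n * (M * norm z)) with (/ INR (S n) * c)
      by (unfold mesh, c, Rdiv; ring).
    pose proof (Rlt_le_trans _ _ _ N1 (Rmin_r _ _)) as H'.
    apply Rmult_lt_compat_r with (r := c + 1) in H'; [|lra].
    replace (eps / 2 / (c + 1) * (c + 1)) with (eps / 2) in H' by (field; lra).
    lra. }
  pose proof (grid_decay inner T M K L n rho x z Hi HT M1 HM K0 L0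
    (Rlt_le _ _ Hrho) n0 HK Hg (H1 (L / INR (S n)) ltac:(lra))
    (Rlt_le _ _ (H2 (L / INR (S n)) ltac:(lra)))) as D.
  apply Rle_trans with (1 := D).
  replace (3 * M * rho) with (eps / 2) by (unfold rho; field; lra).
  apply Rle_trans with (M * (K * (2 * PI / L * (M * norm x) + eps))).
  - do 2 (apply Rmult_le_compat_l; [lra|]).
    rewrite Rplus_assoc. apply Rplus_le_compat_l.
    apply Rle_trans with (eps / 2 + eps / 2); [|lra].
    apply Rplus_le_compat_r. exact Hz.
  - replace (M * (K * (2 * PI / L * (M * norm x) + eps))) with
      (2 * PI * M ^ 2 * K / L * norm x + M * K * eps) by (field; lra).
    apply Rplus_le_compat_l.
    replace e with ((M * K + 1) * eps) by (unfold eps; field; lra).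
    apply Rmult_le_compat_r; lra.
Qed.

Lemma bound_of_dense {V : NormedModule C_AbsRing} (L : V -> V) (D : V -> Prop) B :
  is_linear L -> 0 <= B -> (forall x, D x -> norm (L x) <= B * norm x) ->
  (forall y eps, 0 < eps -> exists x, D x /\ norm (minus x y) <= eps) ->
  forall y, norm (L y) <= B * norm y.
Proof.
  intros HL B0 HD Hd y. apply le_epsilon. intros e He.
  destruct (linear_norm L HL) as [N [N0 HN]].
  destruct (Hd y (e / (N + B))) as [x [Dx Hx]].
  { apply Rdiv_lt_0_compat; lra. }
  pose proof (HD x Dx) as H1.
  pose proof (HN (minus x y)) as H2. rewrite (linear_minus L) in H2 by exact HL.
  assert (H3 : norm (L y) <= norm (L x) + norm (minus (L x) (L y))).
  { apply (norm_eq_le (minus (L x) (minus (L x) (L y)))); [vfield|].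
    apply norm_minus_le. }
  assert (H4 : norm x <= norm (minus x y) + norm y).
  { apply (norm_eq_le (plus (minus x y) y)); [vfield|].
    apply norm_triangle_C. }
  apply Rmult_le_compat_l with (r := B) in H4; [|exact B0].
  assert (H5 : (N + B) * norm (minus x y) <= e).
  { apply Rmult_le_compat_l with (r := N + B) in Hx; [|lra].
    replace ((N + B) * (e / (N + B))) with e in Hx by (field; lra). exact Hx. }
  lra.
Qed.

Lemma resolvent_bound_graph (X : CompleteNormedModule C_AbsRing)
    (A : X -> X -> Prop) lambda K x y :
  resolvent_set A lambda -> Rbar_le (op_norm (resolvent A lambda)) (Finite K) ->
  shift_graph A lambda x y -> norm x <= K * norm y.
Proof.
  intros HR HK H. rewrite (resolvent_unique X A lambda x y HR H).
  apply op_norm_bound; [apply HR | exact HK].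
Qed.

(** * The equivalence *)

Theorem theorem1p1 (X : HilbertSpace) (T : R -> X -> X)
    (hT : is_C0_semigroup T) (hb : bounded_semigroup T) :
  exponentially_stable T <->
  (forall s : R, resolvent_set (generator T) (Ci * RtoC s)%C) /\
  (exists K : R, forall s : R,
     Rbar_le (op_norm (resolvent (generator T) (Ci * RtoC s)%C)) K).
Proof.
  destruct (bounded_semigroup_bound T hT hb) as [M [M1 HM]].
  split.
  - intros Hst.
    destruct (exponentially_stable_contraction T hT Hst) as [tau [Htau Hc]].
    assert (H : forall s, resolvent_set (generator T) (Ci * RtoC s)%C /\
      forall y, norm (resolvent (generator T) (Ci * RtoC s)%C y) <=
                2 * (tau * M) * norm y).
    { intros s. now apply contraction_resolvent. }
    split; [intros s; apply H|].
    exists (2 * (tau * M)). intros s. apply op_norm_le; [|apply H].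
    apply Rmult_le_pos; [lra|]. apply Rmult_le_pos; lra.
  - intros [HR [K0 HK0]].
    set (K := Rmax 0 K0).
    assert (HK : forall s x y, shift_graph (generator T) (Ci * RtoC s)%C x y ->
      norm x <= K * norm y).
    { intros s x y H. apply Rle_trans with (K0 * norm y).
      - exact (resolvent_bound_graph X _ _ K0 x y (HR s) (HK0 s) H).
      - apply Rmult_le_compat_r; [apply norm_ge_0 | apply Rmax_r]. }
    assert (Kpos : 0 <= K) by apply Rmax_l.
    pose proof PI_RGT_0 as HPI.
    set (c := 2 * PI * M ^ 2 * K).
    assert (Hcpos : 0 <= c).
    { apply Rmult_le_pos; [|exact Kpos].
      apply Rmult_le_pos; [lra | apply pow2_ge_0]. }
    (* [orbit_decay] bounds T tau by c / tau, which must be at most 1/2 *)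
    set (tau := 2 * c + 1).
    assert (Htau : 0 < tau) by (unfold tau; lra).
    apply (contraction_exponentially_stable T M tau hT M1 HM Htau).
    apply (bound_of_dense (T tau) (fun x => exists z, generator T x z));
      [apply hT; lra | lra | |].
    + intros x [z Hz].
      apply Rle_trans with (c / tau * norm x).
      * exact (orbit_decay (inner X) T M K tau x z (inner_product X) hT M1 HM
                 Kpos Htau HK Hz).
      * apply Rmult_le_compat_r; [apply norm_ge_0|].
        apply Rmult_le_reg_r with tau; [exact Htau|].
        replace (c / tau * tau) with c by (field; lra). unfold tau; lra.
    + intros y eps Heps.
      destruct (orbit_integral_exists X T M y hT M1 HM) as [F HF].
      destruct (generator_domain_approx T M y F hT HF eps Heps)
        as [x [z [Hz Hx]]].
      exists x. split; [now exists z | exact Hx].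
Qed.
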